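(* Let $b_0,b_1,c_0,c_1,d_0,d_1,e_0,e_1,z_0,z_1$ be non-negative integers such that for $i=0,1$: $b_i+c_i=e_i+z_i$, $b_i=d_i+e_i$, $c_i+d_i=z_i$; put $b=b_0+b_1$, and similarly $c,d,e,z$. Let $\beta\in\binom{[b]}{b_1}$, $\gamma\in\binom{[c]}{c_1}$, $\delta\in\binom{[d]}{d_1}$, $\epsilon\in\binom{[e]}{e_1}$, $\zeta\in\binom{[z]}{z_1}$. If $\mathrm{sort}(\beta)=\mathrm{sort}(\zeta)$ (and hence also $\mathrm{sort}(\gamma)=\mathrm{sort}(\epsilon)$), then $$\mathrm{Pent}(\beta,\gamma,\delta,\epsilon,\zeta)=\mathrm{Pent}(\zeta,\gamma,\delta,\epsilon,\beta)=\mathrm{Pent}(\beta,\epsilon,\delta,\gamma,\zeta)=\mathrm{Pent}(\zeta,\epsilon,\delta,\gamma,\beta),$$ i.e. the pairs $\beta,\zeta$ and $\gamma,\epsilon$ can be commuted independently while preserving the number of pentagonal puzzles.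
   Context: Strings: $\binom{[n]}{k}$ denotes the set of binary strings (words in the symbols $0,1$) of length $n$ with exactly $k$ ones; $\mathrm{sort}(\lambda)=0^{n-k}1^k$ for $\lambda\in\binom{[n]}{k}$. Puzzles: work in the triangular lattice in the plane, whose unit edges make angles $0^\circ,60^\circ,120^\circ$ with the $x$-axis. Edge labels are the three symbols $0$, $1$, $10$ (where $10$ is a single symbol). A unit triangle (upward- or downward-pointing) with labeled edges is an allowed piece if its three labels read clockwise are $(0,0,0)$, $(1,1,1)$, or a cyclic rotation of $(1,0,10)$. Given a convex lattice polygon (sides along lattice directions, some sides possibly of length $0$) each of whose sides is labeled by a binary string, one symbol per unit edge, read clockwise around the polygon, a puzzle with this boundary is an assignment of labels to all unit lattice edges in the polygon which agrees with the prescribed labels on the boundary and for which every unit triangle in the polygon is an allowed piece. $\mathrm{Pent}(\beta,\gamma,\delta,\epsilon,\zeta)$ is the number of puzzles on the convex pentagon whose sides, in clockwise order NW, North, NE, SE, South (there is no SW side; the NW and South sides meet at a $60^\circ$ angle), are labeled respectively $\beta,\gamma,\delta,\epsilon,\zeta$, each read clockwise; the side lengths are the lengths of the strings. *)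

(* Defs.v *)
(* Plain MathComp. *)
From HB Require Import structures.
From mathcomp Require Import all_boot.

Set Implicit Arguments.
Unset Strict Implicit.
Unset Printing Implicit Defensive.

(* Binary words: [false] is the symbol 0 and [true] is the symbol 1. *)
Definition binstr (n k : nat) : pred (seq bool) :=
  [pred w | (size w == n) && (count_mem true w == k)].

Definition bsort (w : seq bool) : seq bool :=
  nseq (size w - count_mem true w) false ++ nseq (count_mem true w) true.

Variant label := L0 | L1 | L10.

Definition label_encode (l : label) : option bool :=
  match l with L0 => Some false | L1 => Some true | L10 => None end.

Definition label_decode (o : option bool) : label :=
  match o with Some false => L0 | Some true => L1 | None => L10 end.

Lemma label_encodeK : cancel label_encode label_decode.
Proof. by case. Qed.

HB.instance Definition _ : Finite label :=
  Finite.copy label (can_type label_encodeK).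

Definition label_of_bit (x : bool) : label := if x then L1 else L0.

(* [(x, y)] is the lattice point x * u + y * v, where u and v are the unit
   vectors making angles 0 and 60 degrees with the x-axis.  Natural number
   coordinates suffice because the polygon below has its SW corner at the
   origin and lies in the cone spanned by u and v. *)
Definition point : Type := (nat * nat)%type.

Variant direction := Deg0 | Deg60 | Deg120.

Definition direction_encode (t : direction) : option bool :=
  match t with Deg0 => Some false | Deg60 => Some true | Deg120 => None end.

Definition direction_decode (o : option bool) : direction :=
  match o with
  | Some false => Deg0 | Some true => Deg60 | None => Deg120
  end.

Lemma direction_encodeK : cancel direction_encode direction_decode.
Proof. by case. Qed.

HB.instance Definition _ : Finite direction :=
  Finite.copy direction (can_type direction_encodeK).

(* Every unit edge is a side of exactly one upward-pointing unit triangle: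
   [(t, p)] is the side of direction [t] of the upward triangle with lower left
   vertex [p].  In particular [(Deg120, p)] does not contain [p]. *)
Definition edge : Type := (direction * point)%type.

Definition endpoints (a : edge) : point * point :=
  let: (t, (x, y)) := a in
  match t with
  | Deg0 => ((x, y), (x.+1, y))
  | Deg60 => ((x, y), (x, y.+1))
  | Deg120 => ((x.+1, y), (x, y.+1))
  end.

(* The sides of the two triangles of the rhombus with lower left vertex
   [(x, y)], each triple in clockwise order: NW, NE, S for the upward triangle
   and N, SE, SW for the downward one. *)
Definition up_sides (p : point) : edge * edge * edge :=
  ((Deg60, p), (Deg120, p), (Deg0, p)).

Definition down_sides (p : point) : edge * edge * edge :=
  let: (x, y) := p in
  ((Deg0, (x, y.+1)), (Deg60, (x.+1, y)), (Deg120, (x, y))).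

(* Label triples of the allowed pieces, read clockwise. *)
Definition pieces : seq (label * label * label) :=
  [:: (L0, L0, L0); (L1, L1, L1);
      (L1, L0, L10); (L0, L10, L1); (L10, L1, L0)].

(* The pentagon with NW, N, NE, SE, S sides of lengths b, c, d, e, z and SW
   corner (0, 0) has vertices (0, 0), (0, b), (c, b), (c + d, b - d) = (z, e),
   (z, 0); it exists only when b = d + e and z = c + d, and [Pent] is meaningful
   only for words whose lengths satisfy these equations.  Being convex, it
   contains a unit edge or triangle iff it contains its vertices. *)
Section Pentagon.
Variables beta gamma delta epsilon zeta : seq bool.

Let b := size beta.
Let c := size gamma.
Let d := size delta.
Let e := size epsilon.
Let z := size zeta.

Definition in_pent (p : point) : bool :=
  [&& p.1 <= z, p.2 <= b & p.1 + p.2 <= b + c].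

Definition edge_in_pent (a : edge) : bool :=
  in_pent (endpoints a).1 && in_pent (endpoints a).2.

Definition up_in_pent (p : point) : bool :=
  let: (x, y) := p in
  [&& in_pent (x, y), in_pent (x.+1, y) & in_pent (x, y.+1)].

Definition down_in_pent (p : point) : bool :=
  let: (x, y) := p in
  [&& in_pent (x.+1, y), in_pent (x, y.+1) & in_pent (x.+1, y.+1)].

Definition pent_box : seq point :=
  [seq (x, y) | x <- iota 0 z.+1, y <- iota 0 b.+1].

Definition pent_edges : seq edge :=
  [seq a <- [seq (t, p) | t <- [:: Deg0; Deg60; Deg120], p <- pent_box]
     | edge_in_pent a].

Definition labeling : finType := {ffun seq_sub pent_edges -> label}.

(* [None] on the edges outside the pentagon. *)
Definition label_at (f : labeling) (a : edge) : option label :=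
  omap f (insub a).

Definition is_piece (f : labeling) (s : edge * edge * edge) : bool :=
  let: (a1, a2, a3) := s in
  (label_at f a1, label_at f a2, label_at f a3)
    \in [seq (Some l.1.1, Some l.1.2, Some l.2) | l <- pieces].

(* Unit edges of the sides, in clockwise order around the pentagon. *)
Definition side_NW : seq edge := [seq (Deg60, (0, i)) | i <- iota 0 b].
Definition side_N : seq edge := [seq (Deg0, (i, b)) | i <- iota 0 c].
Definition side_NE : seq edge :=
  [seq (Deg120, (c + i, b - i.+1)) | i <- iota 0 d].
Definition side_SE : seq edge := [seq (Deg60, (z, e - i.+1)) | i <- iota 0 e].
Definition side_S : seq edge := [seq (Deg0, (z - i.+1, 0)) | i <- iota 0 z].

Definition agrees (f : labeling) (s : seq edge) (w : seq bool) : bool :=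
  [seq label_at f a | a <- s] == [seq Some (label_of_bit x) | x <- w].

Definition is_puzzle (f : labeling) : bool :=
  [&& [&& agrees f side_NW beta, agrees f side_N gamma,
          agrees f side_NE delta, agrees f side_SE epsilon
        & agrees f side_S zeta],
      all (fun p => up_in_pent p ==> is_piece f (up_sides p)) pent_box
    & all (fun p => down_in_pent p ==> is_piece f (down_sides p)) pent_box].

Definition Pent : nat := #|[set f : labeling | is_puzzle f]|.

End Pentagon.

(* Main.v *)
(* Gluing triangles with a sorted side to the N and SE sides turns the pentagon
   into a triangle with NW side beta gamma and S side epsilon zeta. For a fixed
   NE side P, the numbers of triangular puzzles form a matrix from the words on
   the NW side to the words on the S side read from left to right. A Yang-Baxter
   relation moves an auxiliary line through a puzzle, so this matrix commutes
   with the operators H(x) that add vertical strips to the partition of a binary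
   word, with x marking the boxes. The H(x) commute with each other and have
   0...01...1 as a cyclic vector, hence the matrix is a polynomial in them.
   A chain of vertical strips from beta gamma to the reversal of epsilon zeta
   consists of a chain from beta to rev zeta and one from gamma to rev epsilon,
   since the prefixes have the same content. Rotating by 180 degrees reverses a
   chain, and the H(x) commute, so exchanging beta with zeta, or gamma with
   epsilon, does not change the number of weighted chains. *)
Require Import Defs.
From mathcomp Require Import all_boot all_order all_algebra.
From mathcomp Require Import ring zify.

Set Implicit Arguments.
Unset Strict Implicit.
Unset Printing Implicit Defensive.

Import GRing.Theory Num.Theory.
Local Open Scope ring_scope.

(** * Sums over words *)

(** The commutant principle is used twice. It gives a polynomial that depends only on [delta] and
    the contents, so that the four counts are entries of one operator. It also shows that a triangle
    with a sorted side acts as the identity, because it does so at the sorted word; this is why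
    gluing such triangles leaves the count unchanged. The obstacle is the label 10. An auxiliary
    line meets it inside a puzzle, so the vertex tables need three labels, yet they must stay closed
    on binary boundary words. A cutting line might carry it as well; charge conservation excludes
    this because the glued sorted side has the content of [gamma] and [epsilon]. Rational
    coefficients allow a single power of x to be isolated by interpolation. The sorted word is
    cyclic because the resulting homogeneous parts are triangular. *)

Lemma big_tuple_nil (T : finType) (F : seq T -> rat) :
  \sum_(w : 0.-tuple T) F w = F [::].
Proof.
rewrite (bigD1 (nil_tuple T)) //= big1 ?addr0 // => w.
by rewrite (tuple0 w) -val_eqE.
Qed.

Lemma big_tuple_cons (T : finType) n (F : seq T -> rat) :
  \sum_(w : n.+1.-tuple T) F w =
  \sum_(a : T) \sum_(w : n.-tuple T) F (a :: w).
Proof.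
rewrite pair_big /=.
rewrite (reindex (fun p : T * n.-tuple T => [tuple of p.1 :: p.2])) //=.
exists (fun w : n.+1.-tuple T => (thead w, [tuple of behead w])) => [[a w] _|w _].
  by congr pair; apply: val_inj.
by rewrite /= -tuple_eta.
Qed.

Lemma big_tuple_cat (T : finType) m n (F : seq T -> rat) :
  \sum_(w : (m + n).-tuple T) F w =
  \sum_(u : m.-tuple T) \sum_(v : n.-tuple T) F (u ++ v).
Proof.
elim: m F => [|m IHm] F.
  by rewrite (big_tuple_nil (fun u => \sum_(v : n.-tuple T) F (u ++ v))).
rewrite (big_tuple_cons m (fun u => \sum_(v : n.-tuple T) F (u ++ v))).
rewrite (big_tuple_cons (m + n)); apply: eq_bigr => a _.
by rewrite (IHm (fun w => F (a :: w))).
Qed.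

Lemma big_tuple_delta (T : finType) n (u : seq T) (F : seq T -> rat) :
  size u = n -> \sum_(w : n.-tuple T) (u == w)%:R * F w = F u.
Proof.
move=> szu; rewrite (bigD1 (Tuple (introT eqP szu))) //= eqxx mul1r.
rewrite big1 ?addr0 // => w; rewrite -val_eqE eq_sym /= => /negPf->.
by rewrite mul0r.
Qed.

Lemma big_tuple_rev (T : finType) n (F : seq T -> rat) :
  \sum_(w : n.-tuple T) F (rev w) = \sum_(w : n.-tuple T) F w.
Proof.
rewrite [RHS](reindex_inj (h := fun w : n.-tuple T => [tuple of rev w])) //.
by move=> u v /(congr1 val) /(can_inj revK) /val_inj.
Qed.

Lemma big_label (F : label -> rat) : \sum_(a : label) F a = F L0 + F L1 + F L10.
Proof.
rewrite (bigD1 L0) //= (bigD1 L1) //= (bigD1 L10) //= big1 ?addr0 ?addrA //.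
by case.
Qed.

Section Line.
Variables (S A : finType) (V : S -> A -> A -> S -> rat).

(** One row of a vertex model with vertex weight [V] and end states [s], [t]. The same recursion
    serves binary words and puzzle labels. *)
Fixpoint line (s : S) (l r : seq A) (t : S) : rat :=
  match l, r with
  | [::], [::] => (s == t)%:R
  | a :: l', b :: r' => \sum_(u : S) V s a b u * line u l' r' t
  | _, _ => 0
  end.

Lemma line_rcons s l r t a b :
  line s (rcons l a) (rcons r b) t = \sum_(u : S) line s l r u * V u a b t.
Proof.
elim: l s r => [|c l IHl] s [|d r] /=.
- rewrite (bigD1 t) //= eqxx mulr1 [RHS](bigD1 s) //= eqxx mul1r.
  rewrite !big1 ?addr0 // => u /negPf; last by move=> ->; rewrite mulr0.
  by rewrite eq_sym => ->; rewrite !mul0r.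
- rewrite (eq_bigr (fun=> 0)) ?sumr_const ?mul0rn.
    by rewrite big1 // => u _; rewrite !mul0r.
  by move=> u _; case: r => [|? ?] /=; rewrite mulr0.
- rewrite (eq_bigr (fun=> 0)) ?sumr_const ?mul0rn.
    by rewrite big1 // => u _; rewrite !mul0r.
  by move=> u _; case: l {IHl} => [|? ?] /=; rewrite mulr0.
under eq_bigr do rewrite IHl mulr_sumr.
rewrite exchange_big; apply: eq_bigr => u _.
by rewrite !mulr_suml; apply: eq_bigr => v _; rewrite !mulrA.
Qed.

(** [g] is a gauge: read backwards, each vertex changes its weight by a ratio, and these ratios
    telescope along the row. *)
Lemma line_rev (g : S -> rat) s l r t :
    (forall s a b t, V s a b t * g s = V t b a s * g t) -> size l = size r ->
  line s l r t * g s = line t (rev r) (rev l) s * g t.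
Proof.
move=> symV; elim: l s r => [|a l IHl] s [|b r] //=.
  by move=> _; rewrite eq_sym; case: eqP => [->//|_]; rewrite !mul0r.
move=> [szlr]; rewrite !rev_cons line_rcons !mulr_suml.
apply: eq_bigr => u _; rewrite mulrAC symV mulrAC -mulrA IHl //.
by rewrite mulrCA mulrA.
Qed.

End Line.

(** * Vertical strips *)

(* Read from left to right, [a] and [b] are the old and the new letter, and the
   state tells whether a 1 has been written that is still to be removed. Thus
   every 1 moves left by at most one place: if a word encodes the partition
   whose boxes are its pairs 1...0, a vertical strip is added, with [x] marking
   the boxes. *)
Definition vert (s a b t : bool) : bool := (s + b == a + t)%N && (s ==> a).

Definition hops (x : rat) (s : bool) (l r : seq bool) : rat :=
  line (fun s a b t => (vert s a b t)%:R * x ^+ t) s l r false.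

Definition hop x := hops x false.

Lemma hops_cons x s a l b r :
  hops x s (a :: l) (b :: r) =
  \sum_(u : bool) (vert s a b u)%:R * x ^+ u * hops x u l r.
Proof. by []. Qed.

Lemma hop_rev x l r : size l = size r -> hop x l r = hop x (rev r) (rev l).
Proof.
pose V (s a b t : bool) := (vert s a b t)%:R * x ^+ t.
(* The power of [x] sits on the outgoing state; the gauge [x ^+ s] moves it to the incoming one and
   is 1 at the idle ends. *)
have symV s a b t : V s a b t * x ^+ s = V t b a s * x ^+ t.
  rewrite /V -!mulrA [x ^+ t * _]mulrC.
  by congr (_%:R * _); case: s a b t => [] [] [] [].
by move=> szlr; have := line_rev false false symV szlr; rewrite !mulr1.
Qed.

(* Induction on the words with an intertwiner of the two auxiliary lines, whose
   nonzero entries are R(00,00) = R(10,10) = x, R(01,01) = R(11,11) = y and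
   R(01,10) = x - y. *)
Lemma hops_comm_aux x y (l n : seq bool) :
  x != 0 -> size l = size n ->
  let F x y c d := \sum_(m : (size l).-tuple bool) hops x c l m * hops y d m n in
  [/\ F y x false false = F x y false false,
      F y x true false = F x y true false,
      F y x false true = (y * F x y false true + (x - y) * F x y true false) / x
    & F y x true true = y * F x y true true / x].
Proof.
move=> xn0; elim: l n => [|a l IHl] [|b n] //= => [_|[szln]].
  rewrite !(big_tuple_nil (fun m => hops _ _ [::] m * hops _ _ m [::])).
  by rewrite /hops /=; split; field.
have [] := IHl n szln.
set F := fun x y c d => \sum_(m : (size l).-tuple bool) hops x c l m * hops y d m n.
rewrite -!/(F _ _ _ _) => F00 F10 F01 F11.
have E x' y' c d :
    \sum_(m : (size l).+1.-tuple bool) hops x' c (a :: l) m * hops y' d m (b :: n)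
  = \sum_m \sum_c' \sum_d' (vert c a m c')%:R * x' ^+ c' *
      ((vert d m b d')%:R * y' ^+ d') * F x' y' c' d'.
  rewrite (big_tuple_cons (size l) (fun m => hops x' c (a :: l) m * hops y' d m (b :: n))).
  apply: eq_bigr => m0 _.
  transitivity (\sum_(m : (size l).-tuple bool) \sum_c' \sum_d'
     (vert c a m0 c')%:R * x' ^+ c' * ((vert d m0 b d')%:R * y' ^+ d') *
     (hops x' c' l m * hops y' d' m n)).
    apply: eq_bigr => m _; rewrite !hops_cons mulr_suml; apply: eq_bigr => c' _.
    by rewrite mulr_sumr; apply: eq_bigr => d' _; ring.
  rewrite exchange_big; apply: eq_bigr => c' _.
  by rewrite exchange_big; apply: eq_bigr => d' _; rewrite mulr_sumr.
by rewrite !E !big_bool /=; case: (a) (b) => [] []; rewrite /vert /= ?F00 ?F10 ?F01 ?F11;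
  split; field.
Qed.

Lemma hop_comm n x y (u v : seq bool) : size u = n -> size v = n ->
  \sum_(m : n.-tuple bool) hop x u m * hop y m v =
  \sum_(m : n.-tuple bool) hop y u m * hop x m v.
Proof.
move=> szu szv; have szuv : size u = size v by rewrite szu.
(* The auxiliary relations divide by one parameter. By symmetry either may be the nonzero one, and
   for [x = y = 0] the two sides coincide. *)
have [x0|xn0] := eqVneq x 0; last first.
  by have [] := hops_comm_aux y xn0 szuv; rewrite szu => ->.
have [y0|yn0] := eqVneq y 0; first by rewrite x0 y0.
by have [] := hops_comm_aux x yn0 szuv; rewrite szu => ->.
Qed.

Lemma hops_cons_neq0 x s a l b r :
  hops x s (a :: l) (b :: r) != 0 -> exists2 u, vert s a b u & hops x u l r != 0.
Proof.
rewrite hops_cons big_bool.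
case vT: (vert s a b true); case vF: (vert s a b false);
  rewrite ?mul0r ?addr0 ?add0r ?eqxx // => nz.
- by move: vT vF; rewrite /vert; case: (s) (a) (b) => [] [] [].
- by exists true => //; apply: contraNneq nz => ->; rewrite mulr0.
- by exists false => //; apply: contraNneq nz => ->; rewrite mulr0.
Qed.

Lemma hops_neq0_size x s l r : hops x s l r != 0 -> size l = size r.
Proof.
elim: l s r => [|a l IHl] s [|b r] //=.
by case/hops_cons_neq0 => u _ /IHl ->.
Qed.

Local Notation ones := (count_mem true).

(** Ones move to the left, so a prefix can only gain them; a busy entering state stands for a one
    already written before the prefix. *)
Lemma hops_prefix x s l1 r1 l2 r2 : size l1 = size r1 ->
  hops x s (l1 ++ l2) (r1 ++ r2) != 0 -> (ones l1 <= s + ones r1)%N.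
Proof.
elim: l1 s r1 => [|a l IHl] s [|b r] //= [szlr].
case/hops_cons_neq0 => u /andP[/eqP+ _] /(IHl _ _ szlr).
by case: a b s u => [] [] [] [] /=; lia.
Qed.

Lemma hops_ones x s l r : hops x s l r != 0 -> (s + ones r = ones l)%N.
Proof.
move=> nz; have szlr := hops_neq0_size nz; move: szlr nz.
elim: l s r => [|a l IHl] s [|b r] //=; first by case: s; rewrite /hops.
move=> [szlr] /hops_cons_neq0[u /andP[/eqP+ _] /(IHl _ _ szlr)].
by case: a b s u => [] [] [] [] /=; lia.
Qed.

(** Balanced contents force the idle state at the cut, where the sum over states then factors. *)
Lemma hops_cat x (s : bool) l1 r1 l2 r2 :
  size l1 = size r1 -> (s + ones r1 = ones l1)%N ->
  hops x s (l1 ++ l2) (r1 ++ r2) = hops x s l1 r1 * hop x l2 r2.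
Proof.
elim: l1 s r1 => [|a l IHl] s [|b r] //=.
  by case: s => // _ _; rewrite {2}/hops /= mul1r.
move=> [szlr] on; rewrite !hops_cons mulr_suml; apply: eq_bigr => u _.
case vu: (vert s a b u); last by rewrite !mul0r.
rewrite IHl ?mulrA //; move: vu on => /andP[/eqP+ _].
by case: a b s u => [] [] [] [] /=; lia.
Qed.

(** * The algebra generated by the vertical strips *)

Definition kernel := seq bool -> seq bool -> rat.

Definition kcomp n (A B : kernel) : kernel :=
  fun u v => \sum_(w : n.-tuple bool) A u w * B w v.

Definition kcomm n (A B : kernel) : Prop :=
  forall u v, size u = n -> size v = n -> kcomp n A B u v = kcomp n B A u v.

Lemma compA n A B C u v : kcomp n A (kcomp n B C) u v = kcomp n (kcomp n A B) C u v.
Proof.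
rewrite /kcomp; under eq_bigr do rewrite mulr_sumr.
rewrite exchange_big; apply: eq_bigr => w _; rewrite mulr_suml.
by apply: eq_bigr => w' _; rewrite mulrA.
Qed.

Lemma eq_compr n A B C u v :
  (forall w, size w = n -> B w v = C w v) -> kcomp n A B u v = kcomp n A C u v.
Proof. by move=> eqBC; apply: eq_bigr => w _; rewrite eqBC ?size_tuple. Qed.

Lemma eq_compl n A B C u v :
  (forall w, size w = n -> A u w = B u w) -> kcomp n A C u v = kcomp n B C u v.
Proof. by move=> eqAB; apply: eq_bigr => w _; rewrite eqAB ?size_tuple. Qed.

Fixpoint hop_prod n (xs : seq rat) : kernel :=
  if xs is x :: xs' then kcomp n (hop x) (hop_prod n xs')
  else fun u v => (u == v)%:R.

Definition hop_poly n (p : seq (rat * seq rat)) : kernel :=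
  fun u v => \sum_(q <- p) q.1 * hop_prod n q.2 u v.

Lemma comp_deltal n A u v : size u = n -> kcomp n (fun u v => (u == v)%:R) A u v = A u v.
Proof. by move=> szu; apply: (big_tuple_delta (fun w => A w v)). Qed.

Lemma comp_deltar n A u v : size v = n -> kcomp n A (fun u v => (u == v)%:R) u v = A u v.
Proof.
move=> szv; rewrite -[RHS](big_tuple_delta (fun w => A u w) szv).
by apply: eq_bigr => w _; rewrite mulrC eq_sym.
Qed.

Lemma comm_sym n A B : kcomm n A B -> kcomm n B A.
Proof. by move=> cAB u v szu szv; rewrite cAB. Qed.

Lemma comm_hop_prod n A xs : (forall x, kcomm n A (hop x)) -> kcomm n A (hop_prod n xs).
Proof.
move=> cA; elim: xs => [|x xs IHxs] u v szu szv /=.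
  by rewrite comp_deltal ?comp_deltar.
rewrite compA (@eq_compl _ _ (kcomp n (hop x) A)); last by move=> w szw; apply: cA.
rewrite -compA (@eq_compr _ _ _ (kcomp n (hop_prod n xs) A)); last first.
  by move=> w szw; apply: IHxs.
by rewrite compA.
Qed.

Lemma comm_hop_poly n A p : (forall x, kcomm n A (hop x)) -> kcomm n A (hop_poly n p).
Proof.
move=> cA u v szu szv; rewrite /kcomp /hop_poly.
under eq_bigr do rewrite mulr_sumr.
under [RHS]eq_bigr do rewrite mulr_suml.
rewrite exchange_big [RHS]exchange_big; apply: eq_bigr => q _.
under eq_bigr do rewrite mulrCA; under [RHS]eq_bigr do rewrite -mulrA.
by rewrite -!mulr_sumr; congr (_ * _); apply: (comm_hop_prod q.2 cA).
Qed.

Lemma hop_prod_comm n xs x : kcomm n (hop_prod n xs) (hop x).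
Proof. by apply/comm_sym/comm_hop_prod => y u v szu szv; apply: hop_comm. Qed.

Lemma hop_poly_comm n p q : kcomm n (hop_poly n p) (hop_poly n q).
Proof.
apply: comm_hop_poly => x; apply/comm_sym/comm_hop_poly => y u v szu szv.
exact: hop_comm.
Qed.

(** Reversing every step also reverses the order of the factors, which commutativity restores. *)
Lemma hop_prod_rev n xs u v : size u = n -> size v = n ->
  hop_prod n xs u v = hop_prod n xs (rev v) (rev u).
Proof.
elim: xs u v => [|x xs IHxs] u v szu szv /=.
  by rewrite eq_sym (can_eq revK).
transitivity (kcomp n (hop_prod n xs) (hop x) (rev v) (rev u)); last first.
  by apply: hop_prod_comm; rewrite size_rev.
rewrite /kcomp.
rewrite -(big_tuple_rev n (fun w => hop_prod n xs (rev v) w * hop x w (rev u))).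
apply: eq_bigr => w _.
by rewrite mulrC IHxs ?size_tuple // hop_rev ?size_tuple.
Qed.

Lemma hop_prod_prefix m n xs u1 u2 v1 v2 :
    size u1 = m -> size u2 = n -> size v1 = m -> size v2 = n ->
  hop_prod (m + n) xs (u1 ++ u2) (v1 ++ v2) != 0 -> (ones u1 <= ones v1)%N.
Proof.
elim: xs u1 u2 => [|x xs IHxs] u1 u2 szu1 szu2 szv1 szv2 /=.
  have [/eqP|] := eqVneq (u1 ++ u2) (v1 ++ v2); last by rewrite eqxx.
  by rewrite eqseq_cat ?szu1 // => /andP[/eqP-> _].
move=> nz; rewrite leqNgt; apply/negP => lt_vu; case/eqP: nz.
rewrite /kcomp (big_tuple_cat m n (fun w => hop x _ w * hop_prod _ xs w _)).
rewrite big1 // => w1 _; rewrite big1 // => w2 _.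
have [->|] := eqVneq (hop x (u1 ++ u2) (w1 ++ w2)) 0; first by rewrite mul0r.
move=> /hops_prefix; rewrite szu1 size_tuple => /(_ erefl) le_uw.
have [->|] := eqVneq (hop_prod (m + n) xs (w1 ++ w2) (v1 ++ v2)) 0.
  by rewrite mulr0.
move=> /IHxs; rewrite !size_tuple => /(_ erefl erefl szv1 szv2) le_wv.
by have := leq_trans le_uw le_wv; rewrite leqNgt lt_vu.
Qed.

(** Prefix contents can only grow along a chain, so equal ends keep them constant and [hops_cat]
    applies to each step. *)
Lemma hop_prod_cat m n xs u1 u2 v1 v2 :
    size u1 = m -> size u2 = n -> size v1 = m -> size v2 = n ->
    ones u1 = ones v1 ->
  hop_prod (m + n) xs (u1 ++ u2) (v1 ++ v2) =
  hop_prod m xs u1 v1 * hop_prod n xs u2 v2.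
Proof.
elim: xs u1 u2 => [|x xs IHxs] u1 u2 szu1 szu2 szv1 szv2 on /=.
  by rewrite eqseq_cat ?szu1 // -natrM mulnb.
rewrite /kcomp (big_tuple_cat m n (fun w => hop x _ w * hop_prod _ xs w _)).
rewrite mulr_suml; apply: eq_bigr => w1 _; rewrite mulr_sumr; apply: eq_bigr => w2 _.
have [ow1|now1] := eqVneq (ones u1) (ones w1).
  rewrite IHxs ?size_tuple -?ow1 // /hop hops_cat ?size_tuple //.
  by rewrite /hop; ring.
have -> : hop x u1 w1 = 0.
  by apply: contraNeq now1 => /hops_ones; rewrite add0n => ->.
rewrite !mul0r; apply/eqP; apply: contraNT now1.
rewrite mulf_eq0 negb_or => /andP[/hops_prefix + /hop_prod_prefix].
rewrite szu1 !size_tuple add0n => /(_ erefl) le1 /(_ erefl erefl szv1 szv2).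
by rewrite -on => le2; rewrite eqn_leq le1.
Qed.

(* [f] lists the coordinates of a vector in the cyclic module generated by the
   basis vector of [s]. *)
Definition spanned n s (f : seq bool -> rat) : Prop :=
  exists p, forall v, size v = n -> hop_poly n p s v = f v.

Section Spanned.
Variables (n : nat) (s : seq bool).
Hypothesis szs : size s = n.

Lemma eq_spanned f g :
  (forall v, size v = n -> f v = g v) -> spanned n s f -> spanned n s g.
Proof. by move=> eqfg [p Ep]; exists p => v szv; rewrite Ep ?eqfg. Qed.

Lemma spannedD f g : spanned n s f -> spanned n s g -> spanned n s (fun v => f v + g v).
Proof.
move=> [p Ep] [q Eq]; exists (p ++ q) => v szv.
by rewrite /hop_poly big_cat -/(hop_poly n p s v) -/(hop_poly n q s v) Ep ?Eq.
Qed.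

Lemma spannedZ a f : spanned n s f -> spanned n s (fun v => a * f v).
Proof.
move=> [p Ep]; exists [seq (a * q.1, q.2) | q <- p] => v szv.
rewrite /hop_poly big_map -Ep // mulr_sumr.
by apply: eq_bigr => q _; rewrite mulrA.
Qed.

Lemma spanned0 : spanned n s (fun=> 0).
Proof. by exists [::] => v _; rewrite /hop_poly big_nil. Qed.

Lemma spanned_sum (I : finType) (P : pred I) (F : I -> seq bool -> rat) :
  (forall i, P i -> spanned n s (F i)) -> spanned n s (fun v => \sum_(i | P i) F i v).
Proof.
move=> spF; rewrite /index_enum; elim: (Finite.enum I) => [|i r IHr].
  by apply: eq_spanned spanned0 => v _; rewrite big_nil.
case Pi: (P i); last by apply: eq_spanned IHr => v _; rewrite big_cons Pi.
by apply: eq_spanned (spannedD (spF i Pi) IHr) => v _; rewrite big_cons Pi.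
Qed.

Lemma spanned_self : spanned n s (fun v => (s == v)%:R).
Proof. by exists [:: (1, [::])] => v _; rewrite /hop_poly big_seq1 mul1r. Qed.

Lemma spanned_hop x u : size u = n ->
  spanned n s (fun v => (u == v)%:R) -> spanned n s (hop x u).
Proof.
move=> szu [p Ep]; exists [seq (q.1, x :: q.2) | q <- p] => v szv.
transitivity (kcomp n (hop_poly n p) (hop x) s v).
  rewrite /hop_poly big_map /kcomp; under [RHS]eq_bigr do rewrite mulr_suml.
  rewrite exchange_big; apply: eq_bigr => q _ /=.
  under [RHS]eq_bigr do rewrite -mulrA.
  by rewrite -mulr_sumr; congr (_ * _); rewrite -(hop_prod_comm q.2 x).
by rewrite (eq_compl (B := fun _ w => (u == w)%:R)) // [LHS](comp_deltal (hop x)).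
Qed.

End Spanned.

(** * Cyclicity of the sorted word *)

Lemma interpolation n k : (k <= n)%N ->
  exists a t : 'I_n.+1 -> rat,
    forall i : 'I_n.+1, \sum_j a j * t j ^+ i = (i == k :> nat)%:R.
Proof.
move=> lekn; pose t (j : 'I_n.+1) : rat := j%:R.
pose V := Vandermonde n.+1 (\row_j t j).
have uV : V \in unitmx.
  rewrite unitmxE det_Vandermonde unitfE; apply/prodf_neq0 => i _.
  apply/prodf_neq0 => j ltij; rewrite !mxE /t subr_eq0 eqr_nat.
  by rewrite neq_ltn ltij orbT.
pose e : 'cV[rat]_n.+1 := \col_i (i == k :> nat)%:R.
exists (fun j => (invmx V *m e) j 0), t => i.
have /matrixP/(_ i 0) := mulKVmx uV e.
by rewrite !mxE => <-; apply: eq_bigr => j _; rewrite !mxE mulrC.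
Qed.

(* The coefficient of [x ^+ k] in [hops x s l r]. *)
Fixpoint hopk (k : nat) (s : bool) (l r : seq bool) : bool :=
  match l, r with
  | [::], [::] => ~~ s && (k == 0)%N
  | a :: l', b :: r' =>
      (vert s a b false && hopk k false l' r') ||
      (if k is k'.+1 then vert s a b true && hopk k' true l' r' else false)
  | _, _ => false
  end.

(** [vert s a b] admits at most one outgoing state, so a pair of words contributes at most one power
    of [x], with coefficient 1. *)
Lemma hops_hopk x s l r N : (size l < N)%N ->
  hops x s l r = \sum_(k < N) x ^+ k * (hopk k s l r)%:R.
Proof.
elim: l s r N => [|a l IHl] s [|b r] [|N] //= ltN.
- rewrite big_ord_recl big1 => [|k _]; last by rewrite andbF mulr0.
  by rewrite addr0 mul1r andbT /hops /= eqbF_neg.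
- by rewrite /hops /= big1 // => k _; rewrite mulr0.
- by rewrite /hops /= big1 // => k _; rewrite mulr0.
rewrite hops_cons big_bool /= (IHl true r N) // (IHl false r N.+1) 1?ltnW //.
have [vT|vT] := boolP (vert s a b true); have [vF|vF] := boolP (vert s a b false).
- by move: vT vF; rewrite /vert; case: (s) (a) (b) => [] [] [].
- rewrite mul0r addr0 mul1r big_ord_recl /= mulr0 add0r mulr_sumr.
  by apply: eq_bigr => k _; rewrite mulrA -exprD.
- rewrite !mul0r add0r !mul1r; apply: eq_bigr => -[[|k] ltk] _ //=.
    by rewrite orbF.
  by rewrite orbF.
by rewrite !mul0r addr0 big1 // => -[[|k] ltk] _; rewrite mulr0.
Qed.

(** A word of size [n] admits at most [n] marks, so values at [n + 1] nodes determine each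
    homogeneous part. *)
Lemma spanned_hopk n s u k : size s = n -> size u = n -> (k <= n)%N ->
  spanned n s (fun v => (u == v)%:R) ->
  spanned n s (fun v => (hopk k false u v)%:R).
Proof.
move=> szs szu lekn spu; have [a [t at_k]] := interpolation lekn.
apply: eq_spanned (spanned_sum (P := predT)
  (fun j _ => spannedZ (a j) (spanned_hop szs (t j) szu spu))) => v szv.
under eq_bigr do rewrite /hop (@hops_hopk _ _ _ _ n.+1) ?szu // mulr_sumr.
under eq_bigr do under eq_bigr do rewrite mulrA.
rewrite exchange_big /=; under eq_bigr do rewrite -mulr_suml at_k.
rewrite (bigD1 (inord k)) //= inordK // eqxx mul1r big1 ?addr0 // => i.
by rewrite -val_eqE /= inordK // => /negPf->; rewrite mul0r.
Qed.

Lemma hopk_cons k s a l b r : hopk k s (a :: l) (b :: r) ->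
  vert s a b false /\ hopk k false l r \/
  exists2 k', k = k'.+1 & vert s a b true /\ hopk k' true l r.
Proof.
by case/orP => [/andP|]; [left | case: k => // k /andP; right; exists k].
Qed.

Lemma hopk_size_ones k (s : bool) l r :
  hopk k s l r -> size l = size r /\ (s + ones r = ones l)%N.
Proof.
elim: l k s r => [|a l IHl] k s [|b r] //=; first by case: s.
have cases u k' : vert s a b u && hopk k' u l r ->
    (size l).+1 = (size r).+1 /\ (s + ((b == true) + ones r) = (a == true) + ones l)%N.
  case/andP=> /andP[/eqP+ _] /IHl[-> +].
  by move: u a b s => [] [] [] [] /=; lia.
by case/orP=> [/cases //|]; case: k => // k /cases.
Qed.

(** A one moves at most one place to the left, so only the last of the [j + 1] leading zeros can
    change. *)
Lemma hopk_zeros k j l r : hopk k false (nseq j false ++ false :: l) r ->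
  exists2 r', r = nseq j false ++ r' & hopk k false (false :: l) r'.
Proof.
elim: j k r => [|j IHj] k [|b r] //=; first by exists (b :: r).
case/hopk_cons => [[vb /IHj[r' -> ?]]|[k' _ [_]]].
  by exists r' => //; case: b vb.
by case: j {IHj} r => [|j] [|c r] // /hopk_cons[[]|[? _ []]];
  rewrite /vert andbF.
Qed.

Lemma hopk0_eq l r : hopk 0 false l r -> l = r.
Proof.
elim: l r => [|a l IHl] [|b r] //=; rewrite orbF => /andP[+ /IHl->].
by rewrite /vert; case: a b => [] [].
Qed.

(** A busy line copies ones at the cost of one mark each, until it writes a zero. After [m] copies
    no mark is left, so [v] stays unchanged. *)
Lemma hopk_run m v r : hopk m true (nseq m.+1 true ++ v) r ->
  exists i w, [/\ r = nseq i true ++ false :: w, (i <= m)%N & i = m -> w = v].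
Proof.
elim: m r => [|m IHm] [|b r] // /hopk_cons[[vb hk]|[k Ek [vb hk]]] //.
- by exists 0%N, r; split=> // [|_]; [case: b vb | rewrite (hopk0_eq hk)].
- by exists 0%N, r; split=> //; case: b vb.
move: hk; case: Ek => <- /IHm[i [w [-> leim Ew]]].
by exists i.+1, w; split=> // [|[/Ew]] //; case: b vb.
Qed.

Lemma hopk_shift j m v :
  hopk m.+1 false (nseq j.+1 false ++ nseq m.+1 true ++ v)
                  (nseq j false ++ nseq m.+1 true ++ false :: v).
Proof.
have consF k s a l b r : vert s a b false -> hopk k false l r ->
    hopk k s (a :: l) (b :: r) by rewrite /= => -> ->.
have consT k s a l b r : vert s a b true -> hopk k true l r ->
    hopk k.+1 s (a :: l) (b :: r) by rewrite /= => -> ->; rewrite orbT.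
have hopk_refl l : hopk 0 false l l by elim: l => // a l; apply: consF; case: a.
elim: j => [|j IHj]; last exact: consF.
apply: (consT) => //; elim: m => [|m IHm]; first exact: consF.
exact: consT.
Qed.

Lemma ones_prefix (v : seq bool) :
  (exists k, v = nseq k true) \/ (exists k v', v = nseq k true ++ false :: v').
Proof.
elim: v => [|[] v [[k ->]|[k [v' ->]]]]; first by left; exists 0%N.
- by left; exists k.+1.
- by right; exists k.+1, v'.
- by right; exists 0%N, (nseq k true).
- by right; exists 0%N, (nseq k true ++ false :: v').
Qed.

Lemma bsort_sorted j k : bsort (nseq j false ++ nseq k true) = nseq j false ++ nseq k true.
Proof.
by rewrite /bsort size_cat count_cat !size_nseq !count_nseq /= mul0n mul1n add0n addnK.
Qed.


(* The word 0^j 1^k 0 v occurs with coefficient 1 in the degree k part of the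
   vertical strips added to 0^(j+1) 1^k v, whose other terms start with 0^(j+1)
   or with 0^j 1^i 0 for some i < k. *)
Lemma spanned_word n w : size w = n -> spanned n (bsort w) (fun v => (w == v)%:R).
Proof.
move=> szw; set s := bsort w.
have szbs v : size (bsort v) = size v.
  by rewrite /bsort size_cat !size_nseq subnK ?count_size.
have szs : size s = n by rewrite /s szbs.
(* Descending induction on the number [j] of leading zeros; for [j = n + 1] no word of size [n]
   remains. *)
suff spanj d j : (d + j = n.+1)%N -> forall v,
    size v = n -> bsort v = s -> v = nseq j false ++ drop j v ->
    spanned n s (fun u => (v == u)%:R).
  by apply: (spanj n.+1 0%N); rewrite ?addn0 ?drop0.
elim: d j => [|d IHd] j.
  rewrite add0n => -> v szv _ /(congr1 size); rewrite size_cat size_nseq szv; lia.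
rewrite addSnnS => djn v szv bsv.
have spanS u : size u = n -> bsort u = s -> u = nseq j.+1 false ++ drop j.+1 u ->
    spanned n s (fun v => (u == v)%:R) by apply: IHd.
case: (ones_prefix (drop j v)) => [[k ->] Ev|[k [v' ->]]].
  (* Without a further zero the word is sorted, hence is the generator. *)
  by rewrite -{1}bsv {1}Ev bsort_sorted -Ev; apply: spanned_self.
have nseqS i : nseq i.+1 false = rcons (nseq i false) false.
  by rewrite -cats1 -[[:: false]]/(nseq 1 false) -nseqD addn1.
have takeS u : nseq j.+1 false ++ u = nseq j.+1 false ++ drop j.+1 (nseq j.+1 false ++ u).
  by rewrite drop_size_cat ?size_nseq.
have bs_eq u : size u = n -> ones u = ones v -> bsort u = s.
  by move=> szu ou; rewrite -bsv /bsort szu szv ou.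
(* Inner induction on the length of the run of ones after the leading zeros. *)
elim/ltn_ind: k v' v szv bsv bs_eq => -[|m] IHm v' v szv bsv bs_eq Ev.
  apply: spanS => //; rewrite Ev.
  have -> : nseq j false ++ nseq 0 true ++ false :: v' = nseq j.+1 false ++ v'.
    by rewrite [nseq 0 _ ++ _]/= -cat_rcons -nseqS.
  exact: takeS.
pose u := nseq j.+1 false ++ nseq m.+1 true ++ v'.
have hk := hopk_shift j m v'; rewrite -/u -Ev in hk.
have [szu ou] := hopk_size_ones hk; rewrite add0n szv in szu ou.
have lemn : (m.+1 <= n)%N by rewrite -szv Ev !size_cat !size_nseq /=; lia.
have spu := spanS u szu (bs_eq u szu (esym ou)) (takeS _).
have := spanned_hopk szs szu lemn spu => spf.
pose F (w' : n.-tuple bool) x := (hopk m.+1 false u w')%:R * (w' == x :> seq bool)%:R : rat.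
have spF (w' : n.-tuple bool) : tval w' != v -> spanned n s (fun x => -1 * F w' x).
  move=> neq; apply: spannedZ; case hw: (hopk m.+1 false u w'); last first.
    by apply: eq_spanned (spanned0 n s) => x _; rewrite /F hw mul0r.
  apply: (eq_spanned (f := fun x => (w' == x :> seq bool)%:R)).
    by move=> x _; rewrite /F hw mul1r.
  have szw' : size w' = n by rewrite size_tuple.
  have [_ ow'] := hopk_size_ones hw.
  have bsw' : bsort w' = s by apply: bs_eq => //; rewrite ou -ow'.
  have ovw' : ones v = ones w' by rewrite ou -ow'.
  have uE : u = nseq j false ++ false :: nseq m.+1 true ++ v'.
    by rewrite -cat_rcons -nseqS.
  move: hw; rewrite uE => /hopk_zeros[[|b r] Ew'] // /hopk_cons[[vb _]|[k [<-] [vb]]].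
    apply: spanS => //; case: b vb Ew' => // _ ->.
    by rewrite -cat_rcons -nseqS; apply: takeS.
  case/hopk_run => i [x [Er leim Ex]]; case: b vb Ew' => // _ Ew'.
  rewrite Er -[true :: _]/(nseq i.+1 true ++ false :: x) in Ew'.
  apply: (IHm i.+1 _ x) => //.
    rewrite ltnS ltn_neqAle leim andbT; apply: contraNneq neq => im.
    by rewrite Ew' Ev im (Ex im).
  by move=> y szy oy; apply: bs_eq; rewrite ?oy.
(* The expansion at [u] is solved for [v]; each of the other terms is covered by one of the two
   inductions. *)
apply: eq_spanned (spannedD spf (spanned_sum (P := fun w' => tval w' != v) spF)) => x szx.
rewrite -[X in X + _](@big_tuple_delta _ n x (fun w' => (hopk m.+1 false u w')%:R)) //.
rewrite (bigID (fun w' : n.-tuple bool => tval w' != v)) /= addrAC -big_split /=.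
rewrite big1 ?add0r => [|w' _]; last first.
  by rewrite /F mulN1r mulrC eq_sym subrr.
rewrite (big_pred1 (Tuple (introT eqP szv))) => [|w']; last by rewrite negbK /= -val_eqE.
by rewrite -[LHS]/((x == v)%:R * (hopk m.+1 false u v)%:R) hk mulr1 eq_sym.
Qed.

(* All words with the same content lie in one cyclic module over a commutative
   algebra, so an operator in the commutant is determined by its value at the
   generator. *)
Lemma commutant_eq n s M q :
    (forall x, kcomm n M (hop x)) -> size s = n ->
    (forall v, size v = n -> hop_poly n q s v = M s v) ->
  forall u v : seq bool, size u = n -> size v = n -> bsort u = s ->
  M u v = hop_poly n q u v.
Proof.
move=> cM szs qs u v szu szv bsu; have := spanned_word szu.
rewrite bsu => -[p pu].
rewrite -(comp_deltal M v szu) -(comp_deltal (hop_poly n q) v szu).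
transitivity (kcomp n (hop_poly n p) M s v).
  by rewrite [RHS](eq_compl (B := fun _ w => (u == w)%:R)).
transitivity (kcomp n (hop_poly n p) (hop_poly n q) s v); last first.
  by rewrite (eq_compl (B := fun _ w => (u == w)%:R)).
rewrite -(comm_hop_poly p cM) // hop_poly_comm //.
by apply: eq_compl => w szw; rewrite qs.
Qed.

Lemma size_bsort w : size (bsort w) = size w.
Proof. by rewrite /bsort size_cat !size_nseq subnK ?count_size. Qed.

Lemma ones_bsort w : ones (bsort w) = ones w.
Proof. by rewrite /bsort count_cat !count_nseq /= mul0n mul1n. Qed.

Lemma eq_bsort u v : size u = size v -> ones u = ones v -> bsort u = bsort v.
Proof. by rewrite /bsort => -> ->. Qed.

(** The support condition places [M s] in the cyclic module, which supplies the polynomial required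
    by [commutant_eq]. *)
Lemma commutant_poly n s M :
    (forall x, kcomm n M (hop x)) -> size s = n ->
    (forall v, size v = n -> M s v != 0 -> bsort v = s) ->
  exists q, forall u v : seq bool, size u = n -> size v = n -> bsort u = s ->
  M u v = hop_poly n q u v.
Proof.
move=> cM szs Ms; suff [q qs] : spanned n s (M s) by exists q; apply: commutant_eq.
have spM (w : n.-tuple bool) :
    true -> spanned n s (fun v => M s w * (w == v :> seq bool)%:R).
  move=> _; have [Mw0|/(Ms _ (size_tuple w))<-] := eqVneq (M s w) 0.
    by apply: eq_spanned (spanned0 n s) => v _; rewrite Mw0 mul0r.
  by apply/spannedZ/spanned_word; rewrite size_tuple.
apply: eq_spanned (spanned_sum spM) => v szv.
rewrite -[RHS](big_tuple_delta (M s) szv).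
by apply: eq_bigr => w _; rewrite mulrC eq_sym.
Qed.

Lemma hop_poly_revl m n q u1 u2 v1 v2 :
    size u1 = m -> size u2 = n -> size v1 = m -> size v2 = n ->
    ones u1 = ones v1 ->
  hop_poly (m + n) q (u1 ++ u2) (v1 ++ v2) =
  hop_poly (m + n) q (rev v1 ++ u2) (rev u1 ++ v2).
Proof.
move=> szu1 szu2 szv1 szv2 on; apply: eq_bigr => p _.
rewrite !hop_prod_cat ?size_rev ?count_rev // -hop_prod_rev //.
Qed.

Lemma hop_poly_revr m n q u1 u2 v1 v2 :
    size u1 = m -> size u2 = n -> size v1 = m -> size v2 = n ->
    ones u1 = ones v1 ->
  hop_poly (m + n) q (u1 ++ u2) (v1 ++ v2) =
  hop_poly (m + n) q (u1 ++ rev v2) (v1 ++ rev u2).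
Proof.
move=> szu1 szu2 szv1 szv2 on; apply: eq_bigr => p _.
by rewrite !hop_prod_cat ?size_rev ?count_rev // -hop_prod_rev.
Qed.

(** * Moving a line across a puzzle *)

Definition up_ok (l m k : label) : bool := (l, m, k) \in pieces.
Definition down_ok (n r m : label) : bool := (n, r, m) \in pieces.

(** Bottom, left, top and right sides. Two sides of a piece determine the third, so the diagonal [m]
    is unique and this Boolean equals the number of fillings. *)
Definition rhomb (k l j r : label) : bool :=
  has (fun m => up_ok l m k && down_ok j r m) [:: L0; L1; L10].

(* A column of unit triangles between two lines of direction 60: [k] is its
   bottom edge, [l] and [r] are its left and right sides from bottom to top, and
   [p] is the NE side of its topmost triangle. *)
Fixpoint strip (k : label) (l : seq label) (p : label) (r : seq label) : rat :=
  match l, r with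
  | [:: a], [::] => (up_ok a p k)%:R
  | a :: l', b :: r' => \sum_(j : label) (rhomb k a j b)%:R * strip j l' p r'
  | _, _ => 0
  end.

(* Successive columns: [l] and [r] are the left and right sides from bottom to
   top, [P] the NE side from top to bottom, [K] the bottom from left to right. *)
Fixpoint trap (l P K r : seq label) : rat :=
  match P, K with
  | [::], [::] => (l == r)%:R
  | p :: P', k :: K' =>
      \sum_(w : (size l).-1.-tuple label) strip k l p w * trap w P' K' r
  | _, _ => 0
  end.

(* A line crosses the edges of a puzzle; [s] and [t] are its states before and
   after the edge, [a] and [b] the labels to its left and to its right. Labels
   are reused as states, [L0] being the idle one. Both tables restrict to [vert]
   on the labels 0 and 1, with the busy state [L1] on edges of direction 60 and
   [L10] on horizontal edges. The remaining entries are forced by conservation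
   of charge and by [push_rhomb]. *)
Definition vert60 (s a b t : label) : bool :=
  (s, a, b, t) \in
    [:: (L0, L0, L0, L0); (L0, L0, L1, L1); (L0, L1, L1, L0);
        (L0, L10, L1, L10); (L0, L10, L10, L0);
        (L1, L1, L0, L0); (L1, L1, L1, L1);
        (L10, L0, L0, L10); (L10, L1, L1, L10); (L10, L1, L10, L0)].

Definition vert0 (s a b t : label) : bool :=
  (s, a, b, t) \in
    [:: (L0, L0, L0, L0); (L0, L0, L1, L10); (L0, L0, L10, L1);
        (L0, L1, L1, L0); (L0, L10, L10, L0);
        (L1, L1, L1, L1); (L1, L10, L0, L0); (L1, L10, L1, L10);
        (L1, L10, L10, L1);
        (L10, L1, L0, L0); (L10, L1, L1, L10); (L10, L1, L10, L1)].

(** A mark means that the line leaves busy. The two exceptions, [(L10, L0)] here and [(L1, L1)] in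
    [deg0], balance the powers of [x] in [push_rhomb]; they do not occur on binary words. *)
Definition deg60 (s a t : label) : nat := (t != L0) && ((s, a) != (L10, L0)).
Definition deg0 (s a t : label) : nat := (t != L0) && ((s, a) != (L1, L1)).

Definition wt60 (x : rat) s a b t := (vert60 s a b t)%:R * x ^+ deg60 s a t.
Definition wt0 (x : rat) s a b t := (vert0 s a b t)%:R * x ^+ deg0 s a t.

Definition line60 x s l r := line (wt60 x) s l r L0.
Definition line0 x s l r := line (wt0 x) s l r L0.

(** Written out in [nat] so that [vm_compute] can evaluate it. *)
Definition lsum (f : label -> nat) : nat := (f L0 + f L1 + f L10)%N.

Lemma lsumE f : \sum_(a : label) (f a)%:R = (lsum f)%:R :> rat.
Proof. by rewrite big_label -!natrD. Qed.

Definition lcoef i (P : label -> label -> label -> bool)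
    (e : label -> label -> label -> nat) : nat :=
  lsum (fun a => lsum (fun t => lsum (fun j => P a t j && (e a t j == i)))).

Lemma sum_lcoef (x : rat) (P : label -> label -> label -> bool)
    (e : label -> label -> label -> nat) : (forall a t j, e a t j <= 2)%N ->
  \sum_a \sum_t \sum_j (P a t j)%:R * x ^+ (e a t j) =
  \sum_(i < 3) x ^+ i * (lcoef i P e)%:R.
Proof.
move=> e2; rewrite /lcoef; under [RHS]eq_bigr => i do rewrite -lsumE mulr_sumr.
rewrite [RHS]exchange_big; apply: eq_bigr => a _ /=.
under [RHS]eq_bigr => i do rewrite -lsumE mulr_sumr.
rewrite [RHS]exchange_big; apply: eq_bigr => t _ /=.
under [RHS]eq_bigr => i do rewrite -lsumE mulr_sumr.
rewrite [RHS]exchange_big; apply: eq_bigr => j _ /=.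
have := e2 a t j; rewrite !big_ord_recl big_ord0 /=.
by case: (P a t j) (e a t j) => [] [|[|[|]]] //= _; rewrite ?expr0; ring.
Qed.

Lemma push_rhomb_coef i s a k j b u : (i < 3)%N ->
  lcoef i (fun a' t j' => [&& vert60 s a a' t, rhomb k a' j' b & vert0 t j j' u])
          (fun a' t j' => deg60 s a t + deg0 t j u)%N =
  lcoef i (fun k' t b' => [&& vert0 s k' k t, rhomb k' a j b' & vert60 t b' b u])
          (fun k' t b' => deg0 s k' t + deg60 t b' u)%N.
Proof.
case: i => [|[|[|//]]] _; apply/eqP;
  by case: s a k j b u => [] [] [] [] [] []; vm_compute.
Qed.

(** Yang-Baxter relation: the line crosses either the left and top sides or the bottom and right
    sides. The polynomials have degree at most 2 in [x]; their coefficients are compared for all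
    labels. *)
Lemma push_rhomb (x : rat) s a k j b u :
  \sum_a' \sum_t \sum_j' wt60 x s a a' t * ((rhomb k a' j' b)%:R * wt0 x t j j' u) =
  \sum_k' \sum_t \sum_b' wt0 x s k' k t * ((rhomb k' a j b')%:R * wt60 x t b' b u).
Proof.
transitivity (\sum_a' \sum_t \sum_j'
    [&& vert60 s a a' t, rhomb k a' j' b & vert0 t j j' u]%:R *
     x ^+ (deg60 s a t + deg0 t j u)).
  do 3![apply: eq_bigr => ? _]; rewrite /wt60 /wt0 -!mulnb !natrM exprD; ring.
rewrite sum_lcoef; last by move=> *; rewrite (leq_add (leq_b1 _) (leq_b1 _)).
under eq_bigr => i do rewrite push_rhomb_coef //.
rewrite -sum_lcoef; last by move=> *; rewrite (leq_add (leq_b1 _) (leq_b1 _)).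
by do 3![apply: eq_bigr => ? _]; rewrite /wt60 /wt0 -!mulnb !natrM exprD; ring.
Qed.

(** Boundary form of [push_rhomb]: the line ends idle at the NE side, which therefore must not carry
    10. *)
Lemma push_cap x s a p k : p != L10 ->
  \sum_a' wt60 x s a a' L0 * (up_ok a' p k)%:R =
  \sum_k' wt0 x s k' k L0 * (up_ok a p k')%:R :> rat.
Proof.
move=> p10; rewrite /wt60 /wt0.
under eq_bigr do rewrite mulr1 -natrM mulnb.
under [RHS]eq_bigr do rewrite mulr1 -natrM mulnb.
rewrite !lsumE; congr _%:R; apply/eqP.
by case: p p10 s a k => [] // _ [] [] []; vm_compute.
Qed.

Lemma line60_cons x s a l b r :
  line60 x s (a :: l) (b :: r) = \sum_t wt60 x s a b t * line60 x t l r.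
Proof. by []. Qed.

Lemma line0_cons x s a l b r :
  line0 x s (a :: l) (b :: r) = \sum_t wt0 x s a b t * line0 x t l r.
Proof. by []. Qed.

Lemma strip_cons k a l p b r : size l = (size r).+1 ->
  strip k (a :: l) p (b :: r) = \sum_j (rhomb k a j b)%:R * strip j l p r.
Proof. by case: l. Qed.

Lemma sum3_linear (I J K L M : finType) (C : I -> J -> K -> rat)
    (D : I -> J -> K -> L -> M -> rat) (E : L -> M -> rat) :
  \sum_i \sum_j \sum_k C i j k * (\sum_l \sum_m D i j k l m * E l m) =
  \sum_l \sum_m (\sum_i \sum_j \sum_k C i j k * D i j k l m) * E l m.
Proof.
have lin (T : finType) (F : T -> L -> M -> rat) :
    \sum_t \sum_l \sum_m F t l m * E l m = \sum_l \sum_m (\sum_t F t l m) * E l m.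
  rewrite exchange_big; apply: eq_bigr => l _ /=.
  by rewrite exchange_big; apply: eq_bigr => m _ /=; rewrite mulr_suml.
rewrite -lin; apply: eq_bigr => i _; rewrite -lin; apply: eq_bigr => j _.
rewrite -lin; apply: eq_bigr => k _; rewrite mulr_sumr; apply: eq_bigr => l _.
by rewrite mulr_sumr; apply: eq_bigr => m _; rewrite mulrA.
Qed.

(** The line descends through the column: [push_cap] at the top triangle, then [push_rhomb] at each
    rhombus below. *)
Lemma push_strip x p m : p != L10 -> forall s k l r,
    size l = m.+1 -> size r = m ->
  \sum_(l' : m.+1.-tuple label) line60 x s l l' * strip k l' p r =
  \sum_k' \sum_t wt0 x s k' k t *
    \sum_(r' : m.-tuple label) strip k' l p r' * line60 x t r' r.
Proof.
move=> p10; elim: m => [|m IHm] s k [//|a l] r /= [szl] szr.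
  case: l r szl szr => [|//] [|//] _ _.
  have E (F : label -> rat) : \sum_t F t * (t == L0)%:R = F L0.
    by rewrite big_label /= !mulr0 mulr1 !addr0.
  rewrite (big_tuple_cons 0 (fun l' => line60 x s [:: a] l' * strip k l' p [::])).
  transitivity (\sum_a' wt60 x s a a' L0 * (up_ok a' p k)%:R).
    apply: eq_bigr => a' _.
    rewrite (big_tuple_nil (fun l' =>
      line60 x s [:: a] (a' :: l') * strip k (a' :: l') p [::])).
    by rewrite line60_cons E.
  rewrite push_cap //; apply: eq_bigr => k' _.
  transitivity (\sum_t wt0 x s k' k t * (up_ok a p k')%:R * (t == L0)%:R); first by rewrite E.
  apply: eq_bigr => t _.
  by rewrite (big_tuple_nil (fun r' => strip k' [:: a] p r' * line60 x t r' [::])) /= mulrA.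
case: r szr => [//|b r] /= [szr].
pose G j u := \sum_(r' : m.-tuple label) strip j l p r' * line60 x u r' r.
transitivity (\sum_a' \sum_t \sum_j wt60 x s a a' t * (rhomb k a' j b)%:R *
    \sum_j' \sum_u wt0 x t j' j u * G j' u).
  rewrite (big_tuple_cons m.+1 (fun l' => line60 x s (a :: l) l' * strip k l' p (b :: r))).
  apply: eq_bigr => a' _.
  transitivity (\sum_(l' : m.+1.-tuple label) \sum_t \sum_j
      wt60 x s a a' t * (rhomb k a' j b)%:R * (line60 x t l l' * strip j l' p r)).
    apply: eq_bigr => l' _; rewrite line60_cons strip_cons ?size_tuple ?szr // mulr_suml.
    apply: eq_bigr => t _; rewrite mulr_sumr.
    by apply: eq_bigr => j _; ring.
  rewrite exchange_big; apply: eq_bigr => t _.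
  rewrite exchange_big; apply: eq_bigr => j _.
  by rewrite -mulr_sumr IHm.
rewrite sum3_linear.
transitivity (\sum_k' \sum_t \sum_b' wt0 x s k' k t *
    \sum_j' \sum_u (rhomb k' a j' b')%:R * wt60 x t b' b u * G j' u).
  rewrite sum3_linear; apply: eq_bigr => j' _; apply: eq_bigr => u _.
  congr (_ * _); rewrite -push_rhomb.
  by do 3![apply: eq_bigr => ? _]; rewrite mulrA.
apply: eq_bigr => k' _; apply: eq_bigr => t _; rewrite -mulr_sumr; congr (_ * _).
rewrite (big_tuple_cons m (fun r' => strip k' (a :: l) p r' * line60 x t r' (b :: r))).
apply: eq_bigr => b' _.
transitivity (\sum_(r' : m.-tuple label) \sum_j' \sum_u
    (rhomb k' a j' b')%:R * wt60 x t b' b u * (strip j' l p r' * line60 x u r' r)).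
  rewrite [RHS]exchange_big; apply: eq_bigr => j' _ /=.
  by rewrite [RHS]exchange_big; apply: eq_bigr => u _; rewrite mulr_sumr.
apply: eq_bigr => r' _; rewrite line60_cons strip_cons ?szl ?size_tuple // mulr_suml.
by apply: eq_bigr => j' _; rewrite mulr_sumr; apply: eq_bigr => u _; ring.
Qed.

Lemma trap_cons l p P k K r : trap l (p :: P) (k :: K) r =
  \sum_(w : (size l).-1.-tuple label) strip k l p w * trap w P K r.
Proof. by []. Qed.

Lemma push_trap x n : forall s l P K,
    size l = n -> size P = n -> size K = n -> all (predC1 L10) P ->
  \sum_(l' : n.-tuple label) line60 x s l l' * trap l' P K [::] =
  \sum_(K' : n.-tuple label) trap l P K' [::] * line0 x s K' K.
Proof.
elim: n => [|n IHn] s l P K.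
  move=> /size0nil-> /size0nil-> /size0nil-> _.
  rewrite (big_tuple_nil (fun l' => line60 x s [::] l' * trap l' [::] [::] [::])).
  rewrite (big_tuple_nil (fun K' => trap [::] [::] K' [::] * line0 x s K' [::])).
  by rewrite mulrC.
case: P K => [//|p P] [//|k K] szl [szP] [szK] /andP[p10 P10].
transitivity (\sum_(w : n.-tuple label)
   (\sum_(l' : n.+1.-tuple label) line60 x s l l' * strip k l' p w) * trap w P K [::]).
  under [LHS]eq_bigr => l' _ do rewrite trap_cons size_tuple mulr_sumr.
  rewrite [LHS]exchange_big; apply: eq_bigr => w _ /=; rewrite mulr_suml.
  by apply: eq_bigr => l' _; rewrite mulrA.
under [LHS]eq_bigr => w _ do rewrite (push_strip x p10 s k szl (size_tuple w)).
rewrite (big_tuple_cons n (fun K' => trap l (p :: P) K' [::] * line0 x s K' (k :: K))).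
under [LHS]eq_bigr do rewrite mulr_suml; rewrite [LHS]exchange_big; apply: eq_bigr => k' _ /=.
transitivity (\sum_t wt0 x s k' k t * \sum_(r' : n.-tuple label) strip k' l p r' *
   \sum_(w : n.-tuple label) line60 x t r' w * trap w P K [::]).
  under [LHS]eq_bigr do rewrite mulr_suml; rewrite [LHS]exchange_big; apply: eq_bigr => t _ /=.
  under [LHS]eq_bigr do rewrite -mulrA; rewrite -mulr_sumr; congr (_ * _).
  under [LHS]eq_bigr do rewrite mulr_suml; rewrite [LHS]exchange_big; apply: eq_bigr => r' _ /=.
  by rewrite mulr_sumr; apply: eq_bigr => w _; rewrite mulrA.
under [LHS]eq_bigr => t _.
  under eq_bigr => r' _ do rewrite (IHn t r' P K (size_tuple r') szP szK P10).
  over.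
transitivity (\sum_(K' : n.-tuple label) \sum_t
   wt0 x s k' k t * \sum_(r' : n.-tuple label) strip k' l p r' *
     (trap r' P K' [::] * line0 x t K' K)).
  rewrite [RHS]exchange_big; apply: eq_bigr => t _ /=; rewrite -mulr_sumr; congr (_ * _).
  by rewrite [RHS]exchange_big; apply: eq_bigr => r' _ /=; rewrite mulr_sumr.
apply: eq_bigr => K' _; rewrite line0_cons mulr_sumr szl; apply: eq_bigr => t _.
rewrite mulrCA; congr (_ * _); rewrite mulr_suml.
by apply: eq_bigr => r' _; rewrite mulrA.
Qed.

(** * Restriction of the lines to binary words *)

Definition bits := map label_of_bit.
Definition bit10 (s : bool) : label := if s then L10 else L0.

(** Evaluates the table entries alone and leaves the rational expressions to [ring]. *)
Ltac eval_tables :=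
  repeat match goal with
  | |- context [vert60 ?a ?b ?c ?d] =>
      let v := eval vm_compute in (vert60 a b c d) in change (vert60 a b c d) with v
  | |- context [vert0 ?a ?b ?c ?d] =>
      let v := eval vm_compute in (vert0 a b c d) in change (vert0 a b c d) with v
  | |- context [deg60 ?a ?b ?c] =>
      let v := eval vm_compute in (deg60 a b c) in change (deg60 a b c) with v
  | |- context [deg0 ?a ?b ?c] =>
      let v := eval vm_compute in (deg0 a b c) in change (deg0 a b c) with v
  end.

(** In [vert60], a binary state and a binary left label force a binary right label and outgoing
    state. *)
Lemma wt60_bits x s a (F : label -> label -> rat) :
  \sum_b \sum_t wt60 x (label_of_bit s) (label_of_bit a) b t * F b t =
  \sum_b \sum_t (vert s a b t)%:R * x ^+ t * F (label_of_bit b) (label_of_bit t).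
Proof.
rewrite !big_label !big_bool /wt60 /vert.
by case: s a => [] [] /=; eval_tables; rewrite /=; ring.
Qed.

(** On horizontal edges closure runs from right to left, as the given bottom word lies to the right
    of the line. *)
Lemma wt0_bits x s a (F : label -> label -> rat) :
  \sum_b \sum_t wt0 x (bit10 s) b (label_of_bit a) t * F b t =
  \sum_b \sum_t (vert s b a t)%:R * x ^+ t * F (label_of_bit b) (bit10 t).
Proof.
rewrite !big_label !big_bool /wt0 /vert.
by case: s a => [] [] /=; eval_tables; rewrite /=; ring.
Qed.

Lemma line60_bits x n s l (F : seq label -> rat) : size l = n ->
  \sum_(w : n.-tuple label) line60 x (label_of_bit s) (bits l) w * F w =
  \sum_(v : n.-tuple bool) hops x s l v * F (bits v).
Proof.
elim: n s l F => [|n IHn] s l F.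
  move=> /size0nil->.
  rewrite (big_tuple_nil (fun w => line60 x (label_of_bit s) (bits [::]) w * F w)).
  rewrite (big_tuple_nil (fun v => hops x s [::] v * F (bits v))).
  by congr (_ * _); case: s.
case: l => // a l [szl].
rewrite (big_tuple_cons n (fun w => line60 x (label_of_bit s) (bits (a :: l)) w * F w)).
rewrite (big_tuple_cons n (fun v => hops x s (a :: l) v * F (bits v))).
transitivity (\sum_b \sum_t wt60 x (label_of_bit s) (label_of_bit a) b t *
    \sum_(w : n.-tuple label) line60 x t (bits l) w * F (b :: w)).
  apply: eq_bigr => b _.
  under [RHS]eq_bigr do rewrite mulr_sumr; rewrite [RHS]exchange_big.
  apply: eq_bigr => w _; rewrite line60_cons mulr_suml.
  by apply: eq_bigr => t _; rewrite mulrA.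
rewrite wt60_bits; apply: eq_bigr => b _ /=.
under eq_bigr => t _ do rewrite (IHn t l (fun w => F (_ :: w)) szl) mulr_sumr.
rewrite exchange_big; apply: eq_bigr => v _; rewrite hops_cons mulr_suml.
by apply: eq_bigr => t _; rewrite mulrA.
Qed.

Lemma line0_bits x n s r (F : seq label -> rat) : size r = n ->
  \sum_(w : n.-tuple label) F w * line0 x (bit10 s) w (bits r) =
  \sum_(v : n.-tuple bool) F (bits v) * hops x s v r.
Proof.
elim: n s r F => [|n IHn] s r F.
  move=> /size0nil->.
  rewrite (big_tuple_nil (fun w => F w * line0 x (bit10 s) w (bits [::]))).
  rewrite (big_tuple_nil (fun v => F (bits v) * hops x s v [::])).
  by congr (_ * _); case: s.
case: r => // a r [szr].
rewrite (big_tuple_cons n (fun w => F w * line0 x (bit10 s) w (bits (a :: r)))).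
rewrite (big_tuple_cons n (fun v => F (bits v) * hops x s v (a :: r))).
transitivity (\sum_b \sum_t wt0 x (bit10 s) b (label_of_bit a) t *
    \sum_(w : n.-tuple label) F (b :: w) * line0 x t w (bits r)).
  apply: eq_bigr => b _.
  under [RHS]eq_bigr do rewrite mulr_sumr; rewrite [RHS]exchange_big.
  apply: eq_bigr => w _; rewrite line0_cons mulr_sumr.
  by apply: eq_bigr => t _; rewrite mulrCA.
rewrite wt0_bits; apply: eq_bigr => b _ /=.
under eq_bigr => t _ do rewrite (IHn t r (fun w => F (_ :: w)) szr) mulr_sumr.
rewrite exchange_big; apply: eq_bigr => v _; rewrite hops_cons mulr_sumr.
by apply: eq_bigr => t _; rewrite mulrCA.
Qed.

(* Triangular puzzles with NE side [P], as a matrix indexed by the NW side and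
   by the bottom side read from left to right. *)
Definition tri (P : seq bool) : kernel :=
  fun u v => trap (bits u) (bits P) (bits v) [::].

Lemma tri_comm n P x : size P = n -> kcomm n (tri P) (hop x).
Proof.
move=> szP u v szu szv; symmetry; rewrite /kcomp.
rewrite -(line60_bits x false (fun w => trap w (bits P) (bits v) [::]) szu).
rewrite push_trap ?size_map //; last by apply/allP => _ /mapP[[] _ ->].
exact: (line0_bits x false (fun w => trap (bits u) (bits P) w [::]) szv).
Qed.

(** * Conservation of charge *)

Lemma sumr_neq0 (I : finType) (F : I -> rat) : \sum_i F i != 0 -> exists i, F i != 0.
Proof.
move=> nz; case: (pickP (fun i => F i != 0)) => [i ?|F0]; first by exists i.
by case/eqP: nz; rewrite big1 // => i _; have /negbFE/eqP := F0 i.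
Qed.

Lemma mulr_neq0 (b : bool) (y : rat) : b%:R * y != 0 -> b /\ y != 0.
Proof. by case: b; rewrite ?mul1r // mul0r eqxx. Qed.

Lemma rhomb_conserve k a j b : rhomb k a j b ->
  ((a == L1) + (j != L0) = (k != L0) + (b == L1))%N /\
  ((b == L10) + (j == L1) = (k == L1) + (a == L10))%N.
Proof. by case: k a j b => [] [] [] []. Qed.

(* Conservation of charge: assign to each label and each direction of edges a
   vector such that the three vectors add up to zero around every piece. *)
Lemma strip_conserve k l p r : p != L10 -> strip k l p r != 0 ->
  (count_mem L1 l = (k != L0) + count_mem L1 r)%N /\
  ((p == L1) + count_mem L10 r = (k == L1) + count_mem L10 l)%N.
Proof.
move=> p10; elim: l k r => [|a l IHl] k [|b r] //.
  by case: l {IHl} => // /=; case: k a p p10 => [] [] [].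
have [szl|] := eqVneq (size l) 0%N; first by
  rewrite (size0nil szl) /= big1 ?eqxx // => *; rewrite mulr0.
rewrite -lt0n => szl nz; have :
    strip k (a :: l) p (b :: r) = \sum_j (rhomb k a j b)%:R * strip j l p r.
  by case: l szl {IHl nz}.
move: nz => /[swap] -> /sumr_neq0[j /mulr_neq0[/rhomb_conserve[E1 E2] /IHl[F1 F2]]].
split; first by rewrite /= F1 addnA E1 -addnA.
by rewrite /= addnCA F2 addnA E2 -addnA.
Qed.

Lemma trap_conserve l P K r : all (predC1 L10) P -> trap l P K r != 0 ->
  (count_mem L1 l = count (predC1 L0) K + count_mem L1 r)%N /\
  (count_mem L1 P + count_mem L10 r = count_mem L1 K + count_mem L10 l)%N.
Proof.
elim: P l K => [|p P IHP] l [|k K] //.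
  by move=> _ /=; have [->|] := eqVneq l r; rewrite ?eqxx.
rewrite trap_cons => /andP[p10 P10] /sumr_neq0[w nz].
have [snz tnz] : strip k l p w != 0 /\ trap w P K r != 0.
  by move: nz; rewrite mulf_eq0 negb_or => /andP.
have [E1 E2] := strip_conserve p10 snz; have [F1 F2] := IHP _ _ P10 tnz.
split; first by rewrite /= E1 F1 addnA.
by rewrite /= -addnA F2 addnCA E2 addnCA addnA.
Qed.

Lemma count_bits u : (count_mem L1 (bits u) = ones u) * (count_mem L10 (bits u) = 0%N).
Proof.
split; first by rewrite count_map; apply: eq_count => -[].
by rewrite count_map -(count_pred0 u); apply: eq_count => -[].
Qed.

Lemma bits_of_count (w : seq label) : count_mem L10 w = 0%N -> exists u, w = bits u.
Proof.
move/eqP; rewrite -leqn0 leqNgt -has_count => /hasPn w10.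
exists (map (pred1 L1) w); rewrite /bits -map_comp map_id_in //.
by move=> a /w10; case: a.
Qed.

Lemma bits_inj : injective bits.
Proof. by apply: inj_map => -[] []. Qed.

Lemma bits_all u : all (predC1 L10) (bits u).
Proof. by apply/allP => _ /mapP[[] _ ->]. Qed.

(** Conservation makes [ones P] the number of labels 1 in [K] and [ones u] the number of its nonzero
    labels; equality leaves no 10. *)
Lemma trap_bitsr P u K : ones u = ones P -> trap (bits u) (bits P) K [::] != 0 ->
  exists v, K = bits v.
Proof.
move=> on /(trap_conserve (bits_all P))[E1 E2]; apply: bits_of_count.
move: E1 E2; rewrite !count_bits /= !addn0 on => E1 E2.
have E : (count_mem L1 K + count_mem L10 K = count (predC1 L0) K)%N.
  elim: (K) => //= a K' <-; rewrite addnACA; congr (_ + _)%N.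
  by case: a.
by apply/eqP; rewrite -(eqn_add2l (count_mem L1 K)) E addn0 -E1 E2.
Qed.

Lemma trap_bitsl P v l : ones v = ones P -> trap l (bits P) (bits v) [::] != 0 ->
  exists u, l = bits u.
Proof.
move=> on /(trap_conserve (bits_all P))[_]; rewrite !count_bits on => E2.
by apply: bits_of_count; move: E2 => /=; lia.
Qed.

Lemma tri_ones P u v : tri P u v != 0 -> ones u = ones v.
Proof.
move=> /(trap_conserve (bits_all P))[+ _]; rewrite count_bits addn0 => ->.
by rewrite count_map; apply: eq_count => -[].
Qed.

(** * Triangles with a sorted side *)

Lemma sum_label_delta (F : label -> rat) c (b : bool) :
  \sum_j F j * ((j == c) && b)%:R = F c * b%:R.
Proof.
rewrite (bigD1 c) //= eqxx big1 ?addr0 // => j /negPf->.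
by rewrite mulr0.
Qed.

Lemma strip_cons_neq0 k a l p b r : l != [::] ->
  strip k (a :: l) p (b :: r) = \sum_j (rhomb k a j b)%:R * strip j l p r.
Proof. by case: l. Qed.

Lemma strip_ones1 m k r :
  strip k (nseq m.+1 L1) L1 r = ((k == L1) && (r == nseq m L1))%:R.
Proof.
elim: m k r => [|m IHm] k [|b r].
- by case: k.
- by rewrite /= big1 ?andbF // => j _; rewrite mulr0.
- by rewrite /= andbF.
rewrite -[nseq m.+2 L1]/(L1 :: nseq m.+1 L1) strip_cons_neq0 //.
under eq_bigr do rewrite (IHm _ r).
rewrite sum_label_delta eqseq_cons -natrM mulnb; congr (nat_of_bool _)%:R.
by case: k b => [] [].
Qed.

(** The cap 0 over a 1 forces a horizontal 10, which is passed down the column. *)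
Lemma strip_ones0 m k r :
  strip k (nseq m.+1 L1) L0 r = ((k == L10) && (r == nseq m L1))%:R.
Proof.
elim: m k r => [|m IHm] k [|b r].
- by case: k.
- by rewrite /= big1 ?andbF // => j _; rewrite mulr0.
- by rewrite /= andbF.
rewrite -[nseq m.+2 L1]/(L1 :: nseq m.+1 L1) strip_cons_neq0 //.
under eq_bigr do rewrite (IHm _ r).
rewrite sum_label_delta eqseq_cons -natrM mulnb; congr (nat_of_bool _)%:R.
by case: k b => [] [].
Qed.

(** For [n > 0] the horizontal 10 from [strip_ones0] is absorbed at the uppermost 0; below it all
    horizontals are 0. *)
Lemma strip_sorted0 m n k r :
  strip k (nseq m.+1 L0 ++ nseq n L1) L0 r =
  ((k == L0) && (r == nseq m L0 ++ nseq n L1))%:R.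
Proof.
elim: m k r => [|m IHm] k [|b r].
- by case: n => [|n] /=; rewrite ?andbF //; case: k.
- case: n => [|n]; first by rewrite /= big1 ?andbF // => j _; rewrite mulr0.
  rewrite -[_ ++ _]/(L0 :: nseq n.+1 L1) strip_cons_neq0 //.
  under eq_bigr do rewrite (strip_ones0 _ _ r).
  rewrite sum_label_delta eqseq_cons -natrM mulnb; congr (nat_of_bool _)%:R.
  by case: k b => [] [].
- by rewrite /= andbF.
rewrite -[_ ++ _]/(L0 :: (nseq m.+1 L0 ++ nseq n L1)) strip_cons_neq0 //.
under eq_bigr do rewrite (IHm _ r).
rewrite sum_label_delta eqseq_cons -natrM mulnb; congr (nat_of_bool _)%:R.
by case: k b => [] [].
Qed.

(** Each column is forced and hands on the sorted word without its first letter. *)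
Lemma trap_sorted m n K :
  trap (nseq m L0 ++ nseq n L1) (nseq m L0 ++ nseq n L1) K [::] =
  (nseq m L0 ++ nseq n L1 == K)%:R.
Proof.
have step (k k0 : label) w K' n' : size w = n' ->
    \sum_(v : n'.-tuple label) ((k == k0) && (v == w :> seq label))%:R * trap v w K' [::] =
    (k == k0)%:R * trap w w K' [::].
  move=> szw; rewrite -(big_tuple_delta (fun v => trap v w K' [::]) szw) mulr_sumr.
  by apply: eq_bigr => v _; rewrite eq_sym [v == w :> seq _]eq_sym -mulnb natrM mulrA.
elim: m K => [|m IHm] [|k K].
- by case: n.
- elim: n k K => [|n IHn] k K //.
  rewrite trap_cons; under eq_bigr do rewrite strip_ones1.
  rewrite step ?size_nseq //.
  case: K => [|k' K]; rewrite ?eqseq_cons [L1 == k]eq_sym.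
    by case: n {IHn} => [|n] /=; rewrite ?mulr0 ?andbF //= mulr1 andbT.
  by rewrite IHn -natrM mulnb.
- by [].
rewrite trap_cons.
under eq_bigr do rewrite strip_sorted0.
by rewrite step ?size_cat ?size_nseq //= IHm eqseq_cons [L0 == k]eq_sym -natrM mulnb.
Qed.

Lemma bits_bsort s : exists m n, bits (bsort s) = nseq m L0 ++ nseq n L1.
Proof. by rewrite /bits /bsort map_cat !map_nseq; do 2!eexists. Qed.

(** By [trap_sorted], [tri s] agrees with the identity at [s]; [commutant_eq] with the constant
    polynomial 1 extends this to the whole content. *)
Lemma tri_sort n s u v : size u = n -> size v = n -> bsort u = s ->
  tri s u v = (u == v)%:R.
Proof.
move=> szu szv bsu; have szs : size s = n by rewrite -bsu size_bsort.
have := @commutant_eq n s (tri s) [:: (1, [::])] _ szs _ u v szu szv bsu.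
rewrite /hop_poly big_seq1 mul1r; apply; first by move=> x; apply: tri_comm.
move=> w szw; rewrite big_seq1 mul1r /tri.
have [a [b E]] := bits_bsort u; rewrite bsu in E.
by rewrite E trap_sorted -E (inj_eq bits_inj).
Qed.

(** * Cutting off the corners *)

(* As [strip] and [trap], for columns ending with a horizontal edge [t]. *)
Fixpoint pstrip (k : label) (l : seq label) (t : label) (r : seq label) : rat :=
  match l, r with
  | [::], [::] => (k == t)%:R
  | a :: l', b :: r' => \sum_(j : label) (rhomb k a j b)%:R * pstrip j l' t r'
  | _, _ => 0
  end.

Fixpoint par (l T K r : seq label) : rat :=
  match T, K with
  | [::], [::] => (l == r)%:R
  | t :: T', k :: K' =>
      \sum_(w : (size l).-tuple label) pstrip k l t w * par w T' K' r
  | _, _ => 0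
  end.

Lemma strip_cat k l1 l2 p r1 r2 : size l1 = size r1 -> l2 != [::] ->
  strip k (l1 ++ l2) p (r1 ++ r2) = \sum_j pstrip k l1 j r1 * strip j l2 p r2.
Proof.
move=> szlr l2n; elim: l1 r1 k szlr => [|a l1 IHl] [|b r1] // k.
  move=> _; rewrite /= (bigD1 k) //= eqxx mul1r big1 ?addr0 // => j.
  by rewrite eq_sym => /negPf->; rewrite mul0r.
move=> [szlr]; rewrite !cat_cons strip_cons_neq0; last by case: (l1).
under eq_bigr do rewrite IHl // mulr_sumr.
rewrite exchange_big; apply: eq_bigr => j _ /=; rewrite mulr_suml.
by apply: eq_bigr => i _; rewrite mulrA.
Qed.

Lemma par_cons l t T k K r : par l (t :: T) (k :: K) r =
  \sum_(w : (size l).-tuple label) pstrip k l t w * par w T K r.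
Proof. by []. Qed.

(** A horizontal cut labeled [T] divides the first [c] columns into a triangle above and a
    parallelogram below; [w] labels the line separating the parallelogram from the later columns. *)
Lemma trap_split_top m c l1 l2 P1 P2 K1 K2 r :
    size l1 = m -> size l2 = c -> size P1 = c -> size K1 = c ->
  trap (l1 ++ l2) (P1 ++ P2) (K1 ++ K2) r =
  \sum_(T : c.-tuple label) trap l2 P1 T [::] *
    \sum_(w : m.-tuple label) par l1 T K1 w * trap w P2 K2 r.
Proof.
elim: c l1 l2 P1 K1 => [|c IHc] l1 l2 P1 K1 szl1.
  move=> /size0nil-> /size0nil-> /size0nil->; rewrite cats0.
  rewrite (big_tuple_nil (fun T => trap [::] [::] T [::] *
    \sum_(w : m.-tuple label) par l1 T [::] w * trap w P2 K2 r)) mul1r.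
  by rewrite (big_tuple_delta (fun w => trap w P2 K2 r)).
case: l2 P1 K1 => [//|a l2] [//|p P1] [//|k K1] szl2 [szP1] [szK1].
rewrite !cat_cons trap_cons size_cat szl1 szl2 addnS [_.+1.-1]/=.
rewrite (big_tuple_cat m c (fun v => strip k (l1 ++ a :: l2) p v * trap v _ _ r)).
rewrite (big_tuple_cons c (fun T => trap (a :: l2) (p :: P1) T [::] *
    \sum_(w : m.-tuple label) par l1 T (k :: K1) w * trap w P2 K2 r)).
pose X j (v2 T : seq label) := strip j (a :: l2) p v2 * trap v2 P1 T [::].
pose Y j (v1 T w : seq label) := pstrip k l1 j v1 * par v1 T K1 w * trap w P2 K2 r.
transitivity (\sum_(v1 : m.-tuple label) \sum_(v2 : c.-tuple label) \sum_j
  \sum_(T : c.-tuple label) \sum_(w : m.-tuple label) X j v2 T * Y j v1 T w).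
  apply: eq_bigr => v1 _; apply: eq_bigr => v2 _.
  rewrite strip_cat ?size_tuple // mulr_suml; apply: eq_bigr => j _.
  rewrite IHc ?size_tuple // mulr_sumr; apply: eq_bigr => T _.
  by rewrite !mulr_sumr; apply: eq_bigr => w _; rewrite /X /Y; ring.
transitivity (\sum_j \sum_(T : c.-tuple label) \sum_(w : m.-tuple label)
  \sum_(v2 : c.-tuple label) \sum_(v1 : m.-tuple label) X j v2 T * Y j v1 T w).
  rewrite exchange_big /=.
  under eq_bigr => v2 _ do rewrite exchange_big /=.
  rewrite exchange_big /=; apply: eq_bigr => j _.
  under eq_bigr => v2 _ do rewrite exchange_big /=.
  rewrite exchange_big /=; apply: eq_bigr => T _.
  under eq_bigr => v2 _ do rewrite exchange_big /=.
  by rewrite exchange_big.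
apply: eq_bigr => j _; apply: eq_bigr => T _; rewrite trap_cons szl2 mulr_sumr.
apply: eq_bigr => w _; rewrite par_cons szl1 !mulr_suml.
apply: eq_bigr => v2 _; rewrite mulr_sumr.
by apply: eq_bigr => v1 _; rewrite /X /Y; ring.
Qed.

Lemma trap_split_right n l P1 P2 K1 K2 r :
    size K1 = size P1 -> size l = (size P1 + n)%N ->
  trap l (P1 ++ P2) (K1 ++ K2) r =
  \sum_(w : n.-tuple label) trap l P1 K1 w * trap w P2 K2 r.
Proof.
elim: P1 K1 l => [|p P1 IHP] [|k K1] // l.
  by move=> _ szl; rewrite (big_tuple_delta (fun w => trap w P2 K2 r)).
move=> [szK] szl; rewrite !cat_cons trap_cons.
transitivity (\sum_(v : (size l).-1.-tuple label) \sum_(w : n.-tuple label)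
  strip k l p v * (trap v P1 K1 w * trap w P2 K2 r)).
  by apply: eq_bigr => v _; rewrite IHP ?size_tuple ?szl // mulr_sumr.
rewrite exchange_big; apply: eq_bigr => w _; rewrite trap_cons mulr_suml.
by apply: eq_bigr => v _; rewrite mulrA.
Qed.

(* Triangles with the sorted side [s] have to be filled at the top and at the
   right corner, which forces the labels of the cutting lines. *)
Lemma tri_corners s beta gamma delta K1 K2 v2 :
    size gamma = size s -> ones gamma = ones s ->
    size v2 = size s -> ones v2 = ones s -> bsort s = s ->
    size K1 = size s -> size K2 = size delta ->
    size beta = (size delta + size s)%N ->
  tri (s ++ delta ++ s) (beta ++ gamma) ((K1 ++ K2) ++ v2) =
  \sum_(w : (size beta).-tuple label)
    par (bits beta) (bits gamma) (bits K1) w *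
    trap w (bits delta) (bits K2) (bits v2).
Proof.
move=> szg og szv ov bs szK1 szK2 szb; pose c := size s.
have bsg : bsort gamma = s by rewrite -bs; apply: eq_bsort.
have bsv : bsort v2 = s by rewrite -bs; apply: eq_bsort.
rewrite /tri /bits !map_cat -catA -!/(bits _).
rewrite (@trap_split_top (size beta) c) ?size_map //.
pose X (T : seq label) := \sum_(w : (size beta).-tuple label)
  par (bits beta) T (bits K1) w * trap w (bits delta) (bits K2) (bits v2).
rewrite -[RHS]/(X (bits gamma)).
have szbg : size (bits gamma) = c by rewrite size_map.
rewrite -(big_tuple_delta X szbg); apply: eq_bigr => T _.
(* Conservation makes [T] binary, and [tri_sort] leaves only [bits gamma]. If there is no filling,
   [T] cannot be [bits gamma], which has one. *)
have [T0|/(trap_bitsr og)[g' Tg']] := eqVneq (trap (bits gamma) (bits s) T [::]) 0.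
  rewrite T0 mul0r; have [Tg|_] := eqVneq (bits gamma) T; last by rewrite mul0r.
  move: T0; rewrite -Tg -/(tri s gamma gamma) (@tri_sort c) // eqxx.
  by move/eqP; rewrite oner_eq0.
have szg' : size g' = c by rewrite -(size_map label_of_bit) -/(bits _) -Tg' size_tuple.
rewrite Tg' -/(tri s gamma g') (@tri_sort c) // (inj_eq bits_inj).
have [<-|_] := eqVneq gamma g'; last by rewrite !mul0r.
rewrite !mul1r /X; apply: eq_bigr => w _; congr (_ * _).
rewrite (@trap_split_right c) ?size_tuple ?size_map //.
have szbv : size (bits v2) = c by rewrite size_map.
rewrite -(big_tuple_delta (fun x => trap w (bits delta) (bits K2) x) szbv).
apply: eq_bigr => x _; rewrite mulrC; congr (_ * _).
have [T0|nz] := eqVneq (trap x (bits s) (bits v2) [::]) 0.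
  have [vx|//] := eqVneq (bits v2) x.
  by rewrite T0; move: T0; rewrite -vx -/(tri s v2 v2) (@tri_sort c) // eqxx.
have [u xu] := trap_bitsl ov nz.
have szu : size u = c by rewrite -(size_map label_of_bit) -/(bits _) -xu size_tuple.
have ou : ones u = ones s by rewrite -ov; apply: (@tri_ones s); rewrite /tri -xu.
rewrite xu -/(tri s u v2) (@tri_sort c) // ?(inj_eq bits_inj) 1?eq_sym //.
by rewrite -bs; apply: eq_bsort.
Qed.

(** * From labelings to columns *)

Section Assign.
Implicit Types (g : edge -> label) (E : seq edge) (w : seq label).

Definition assign g E w : edge -> label :=
  fun a => if a \in E then nth L0 w (index a E) else g a.

Definition local (D : seq edge) (Phi : (edge -> label) -> bool) : Prop :=
  forall g g', {in D, g =1 g'} -> Phi g = Phi g'.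

Definition count_assign E g (Phi : (edge -> label) -> bool) : rat :=
  \sum_(w : (size E).-tuple label) (Phi (assign g E w))%:R.

Lemma assign_cat g E1 E2 w1 w2 : size w1 = size E1 -> [predI E1 & E2] =1 pred0 ->
  assign (assign g E1 w1) E2 w2 =1 assign g (E1 ++ E2) (w1 ++ w2).
Proof.
move=> szw dis a; rewrite /assign mem_cat index_cat nth_cat szw.
case: ifP => [aE2|_]; last by rewrite orbF; case: ifP => // aE1; rewrite index_mem aE1.
have /= := dis a; rewrite aE2 andbT => /negbT/negPf->.
by rewrite /= ltnNge leq_addr /= addKn.
Qed.

Lemma count_assign_cat E1 E2 g Phi D :
    local D Phi -> [predI E1 & E2] =1 pred0 ->
  count_assign (E1 ++ E2) g Phi =
  \sum_(w : (size E1).-tuple label) count_assign E2 (assign g E1 w) Phi.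
Proof.
move=> locP dis; rewrite /count_assign size_cat.
rewrite (big_tuple_cat _ _ (fun w => (Phi (assign g (E1 ++ E2) w))%:R)).
apply: eq_bigr => w1 _; apply: eq_bigr => w2 _; congr (nat_of_bool _)%:R.
(* Locality replaces functional extensionality: the two assignments agree only pointwise. *)
by apply: locP => a _; rewrite assign_cat ?size_tuple.
Qed.

Lemma assign_notin g E w a : a \notin E -> assign g E w a = g a.
Proof. by rewrite /assign => /negPf->. Qed.

Lemma map_assign g E w : uniq E -> size w = size E -> map (assign g E w) E = w.
Proof.
move=> uE szw; apply: (@eq_from_nth _ L0); rewrite size_map // => i lti.
have x0 : edge by exact: (Deg0, (0, 0)).
by rewrite (nth_map x0) // /assign mem_nth // index_uniq.
Qed.

Lemma map_assign_notin g E E' w : [predI E' & E] =1 pred0 ->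
  map (assign g E w) E' = map g E'.
Proof.
move=> dis; apply/eq_in_map => a aE'; apply: assign_notin.
by have /= := dis a; rewrite aE' /= => ->.
Qed.

(** [E'] lists the edges in an order suited to the count, and total functions with default [L0]
    replace the domain [seq_sub E]. *)
Lemma card_assign (E E' : seq edge) (Phi : (edge -> label) -> bool)
    (Phi' : {ffun seq_sub E -> label} -> bool) :
    uniq E' -> E' =i E ->
    (forall (f : {ffun seq_sub E -> label}) g,
      (forall a : seq_sub E, g (val a) = f a) -> Phi' f = Phi g) ->
  (#|[set f | Phi' f]|)%:R = count_assign E' (fun=> L0) Phi.
Proof.
move=> uE' eqE' Phi'E; rewrite /count_assign.
pose F (w : (size E').-tuple label) : {ffun seq_sub E -> label} :=
  [ffun a => nth L0 w (index (val a) E')].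
pose G (f : {ffun seq_sub E -> label}) : (size E').-tuple label :=
  [tuple of map (fun a => oapp f L0 (insub a)) (in_tuple E')].
rewrite -sum1_card natr_sum (reindex F) /=; last first.
  exists G => [w _|f _].
    apply: eq_from_tnth => i.
    have x0 : edge by exact: (Deg0, (0, 0)).
    rewrite tnth_map (tnth_nth x0) /=.
    have aE : nth x0 E' i \in E by rewrite -eqE' mem_nth.
    by rewrite insubT /= ffunE /= index_uniq // (tnth_nth L0).
  apply/ffunP => a; rewrite ffunE.
  have x0 : edge by exact: (Deg0, (0, 0)).
  have aE' : val a \in E' by rewrite eqE' ssvalP.
  by rewrite (nth_map x0) ?index_mem // nth_index // valK.
rewrite [LHS]big_mkcond /=; apply: eq_bigr => w _; rewrite inE.
rewrite (Phi'E _ (assign (fun=> L0) E' w)); first by case: (Phi _).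
by move=> a; rewrite ffunE /assign eqE' ssvalP.
Qed.

End Assign.

(* Edges of a column from bottom to top: [l] and [r] of direction 60, [m] of
   direction 120 and [k] horizontal. The column ends with a horizontal edge or
   with an edge of direction 120. *)
Fixpoint fits (l m k r : seq label) : bool :=
  match l, m, k, r with
  | [::], [::], [:: _], [::] => true
  | [:: a], [:: m0], [:: k0], [::] => up_ok a m0 k0
  | a :: l', m0 :: m', k0 :: ((k1 :: _) as k'), b :: r' =>
      [&& up_ok a m0 k0, down_ok k1 b m0 & fits l' m' k' r']
  | _, _, _, _ => false
  end.

Lemma fits_cons a l m0 m k0 k1 k b r :
  fits (a :: l) (m0 :: m) (k0 :: k1 :: k) (b :: r) =
  [&& up_ok a m0 k0, down_ok k1 b m0 & fits l m (k1 :: k) r].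
Proof. by case: l m => [|? ?] [|? ?]. Qed.

Lemma fits_iota (A B C D : nat -> label) (cap : bool) n y :
  fits (map A (iota y (n + ~~ cap))) (map B (iota y (n + ~~ cap)))
       (map C (iota y n.+1)) (map D (iota y n)) =
  all (fun i => up_ok (A i) (B i) (C i)) (iota y (n + ~~ cap)) &&
  all (fun i => down_ok (C i.+1) (D i) (B i)) (iota y n).
Proof.
elim: n y => [|n IHn] y; first by case: cap; rewrite /= ?andbT.
rewrite addSn -[iota y n.+2]/[:: y, y.+1 & iota y.+2 n] -[iota y n.+1]/(y :: iota y.+1 n).
rewrite -[iota y (_.+1)]/(y :: iota y.+1 (n + ~~ cap)) !map_cons fits_cons.
by rewrite -!map_cons (IHn y.+1) /= -!andbA; congr andb; rewrite andbCA.
Qed.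

(* [cap] tells whether the column ends with a horizontal edge. *)
Definition cell (cap : bool) (k : label) (l : seq label) (t : label) r : rat :=
  if cap then pstrip k l t r else strip k l t r.

Lemma cell_cons cap k a l t b r : size l = (size r + ~~ cap)%N ->
  cell cap k (a :: l) t (b :: r) = \sum_j (rhomb k a j b)%:R * cell cap j l t r.
Proof.
rewrite /cell; case: cap => // szl; rewrite strip_cons_neq0 //.
by case: l szl => //; rewrite addn1.
Qed.

(** Summing out the diagonals joins triangles into rhombi, so the inner edges of a column reduce to
    its transfer weight. *)
Lemma sum_fits cap t n : forall l r k0, size l = (n + ~~ cap)%N -> size r = n ->
  \sum_(k : n.+1.-tuple label) \sum_(m : (n + ~~ cap).-tuple label)
    [&& fits l m k r, head L0 k == k0 &
        (if cap then last L0 k else last L0 m) == t]%:R =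
  cell cap k0 l t r.
Proof.
elim: n => [|n IHn] l r k0 szl szr.
  rewrite (size0nil szr); case: cap szl => [/size0nil->|].
    rewrite (big_tuple_cons 0 (fun k => \sum_(m : 0.-tuple label)
      [&& fits [::] m k [::], head L0 k == k0 & last L0 k == t]%:R)).
    under eq_bigr => k1 _.
      rewrite (big_tuple_nil (fun k => \sum_(m : 0.-tuple label)
        [&& fits [::] m (k1 :: k) [::], k1 == k0 & last k1 k == t]%:R)).
      rewrite (big_tuple_nil (fun m =>
        [&& fits [::] m [:: k1] [::], k1 == k0 & k1 == t]%:R)) /=.
      over.
    rewrite (bigD1 k0) //= eqxx big1 ?addr0 // => k1 /negPf-> //.
  case: l => [//|a [|//]] _.
  rewrite (big_tuple_cons 0 (fun k => \sum_(m : 1.-tuple label)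
    [&& fits [:: a] m k [::], head L0 k == k0 & last L0 m == t]%:R)).
  under eq_bigr => k1 _.
    rewrite (big_tuple_nil (fun k => \sum_(m : 1.-tuple label)
      [&& fits [:: a] m (k1 :: k) [::], k1 == k0 & last L0 m == t]%:R)).
    rewrite (big_tuple_cons 0 (fun m =>
      [&& fits [:: a] m [:: k1] [::], k1 == k0 & last L0 m == t]%:R)).
    under eq_bigr => m1 _.
      rewrite (big_tuple_nil (fun m =>
        [&& fits [:: a] (m1 :: m) [:: k1] [::], k1 == k0 & last m1 m == t]%:R)) /=.
      over.
    rewrite (bigD1 t) //= eqxx big1 ?addr0 => [|m1 /negPf->]; last by rewrite !andbF.
    over.
  rewrite (bigD1 k0) //= eqxx big1 ?addr0 => [|k1 /negPf->]; last by rewrite andbF.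
  by rewrite !andbT.
case: l szl => // a l [szl]; case: r szr => // b r [szr].
rewrite cell_cons ?szr //.
rewrite (big_tuple_cons n.+1 (fun k => \sum_(m : (n.+1 + ~~ cap).-tuple label)
  [&& fits (a :: l) m k (b :: r), head L0 k == k0 &
      (if cap then last L0 k else last L0 m) == t]%:R)).
pose X k m : bool := fits l m k r && ((if cap then last L0 k else last L0 m) == t).
transitivity (\sum_k1 \sum_(k : n.+1.-tuple label) \sum_m1
  \sum_(m : (n + ~~ cap).-tuple label)
    [&& k1 == k0, up_ok a m1 k1, down_ok (head L0 k) b m1 & X k m]%:R : rat).
  apply: eq_bigr => k1 _; apply: eq_bigr => k _.
  rewrite (big_tuple_cons (n + ~~ cap) (fun m =>
   [&& fits (a :: l) m (k1 :: k) (b :: r), k1 == k0 &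
      (if cap then last k1 k else last L0 m) == t]%:R)).
  apply: eq_bigr => m1 _; apply: eq_bigr => m _; congr (nat_of_bool _)%:R.
  case: k => -[|k2 k] //= szk.
  rewrite -/(fits (a :: l) (m1 :: m) (k1 :: k2 :: k) (b :: r)) fits_cons /X /=.
  have -> : (if cap then last k2 k else last m1 m) = (if cap then last k2 k else last L0 m).
    by case: (cap) m => //; rewrite addn1 => -[[|? ?]].
  by case: (k1 == k0); rewrite ?andbF ?andbT //= -!andbA.
rewrite (bigD1 k0) //= [X in _ + X]big1 ?addr0; last first.
  move=> k1 /negPf k1k0; rewrite big1 // => k _; rewrite big1 // => m1 _.
  by rewrite big1 // => m _; rewrite k1k0.
under eq_bigr do under eq_bigr do under eq_bigr do rewrite eqxx /=.
transitivity (\sum_j \sum_(k : n.+1.-tuple label) \sum_(m : (n + ~~ cap).-tuple label)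
   (rhomb k0 a j b)%:R * [&& fits l m k r, head L0 k == j &
        (if cap then last L0 k else last L0 m) == t]%:R : rat); last first.
  apply: eq_bigr => j _; rewrite -IHn // mulr_sumr.
  by apply: eq_bigr => k _; rewrite mulr_sumr.
rewrite [RHS]exchange_big; apply: eq_bigr => k _ /=.
rewrite [LHS]exchange_big [RHS]exchange_big; apply: eq_bigr => m _ /=.
rewrite [RHS](bigD1 (head L0 k)) //= eqxx [X in _ = _ + X]big1 ?addr0 => [|j]; last first.
  by rewrite eq_sym => /negPf->; rewrite andbF mulr0.
(* The remaining sum over the lowest diagonal counts the fillings of one rhombus. *)
rewrite andTb -/(X k m) big_label -!natrD -natrM; congr _%:R.
by case: (X k m); rewrite ?andbT ?andbF ?muln1 ?muln0 //; case: k0 a b (head L0 k) => [] [] [] [].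
Qed.

Lemma map_eqP (T : eqType) (x0 : T) (F : nat -> T) n (w : seq T) : size w = n ->
  reflect (forall i, (i < n)%N -> F i = nth x0 w i) (map F (iota 0 n) == w).
Proof.
move=> szw; apply: (iffP eqP) => [<- i ltin|Fw].
  by rewrite (nth_map 0%N) ?size_iota // nth_iota.
apply: (@eq_from_nth _ x0); rewrite size_map size_iota // => i ltin.
by rewrite (nth_map 0%N) ?size_iota // nth_iota // Fw.
Qed.

(** * The pentagon as a sequence of columns *)

Section Columns.
Variables beta gamma delta epsilon zeta : seq bool.
Let b := size beta.
Let c := size gamma.
Let d := size delta.
Let e := size epsilon.
Let z := size zeta.
Hypothesis b_eq : b = (d + e)%N.
Hypothesis z_eq : z = (c + d)%N.
Implicit Types g : edge -> label.

Let edgesP := pent_edges beta gamma zeta.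

(** The length of the segment of direction 60 at [x]: constant under the N side, then decreasing
    under the NE side. *)
Definition height (x : nat) : nat := minn b (b + c - x).

Definition edges60 x : seq edge := [seq (Deg60, (x, y)) | y <- iota 0 (height x)].
Definition edges120 x : seq edge := [seq (Deg120, (x, y)) | y <- iota 0 (height x)].
Definition edges0 x : seq edge := [seq (Deg0, (x, y)) | y <- iota 0 (height x.+1).+1].

(** The left side is left to the preceding column, which keeps columns disjoint; only [edges60 0]
    has to be added. *)
Definition column x : seq edge := edges0 x ++ edges120 x ++ edges60 x.+1.
(* The last [n] columns. *)
Fixpoint columns n : seq edge :=
  if n is n'.+1 then column (z - n) ++ columns n' else [::].

Definition bottoms : seq label := bits (rev zeta).
Definition caps : seq label := bits (gamma ++ delta).

Definition column_ok x g : bool :=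
  [&& fits (map g (edges60 x)) (map g (edges120 x)) (map g (edges0 x)) (map g (edges60 x.+1)),
      head L0 (map g (edges0 x)) == nth L0 bottoms x &
      (if (x < c)%N then last L0 (map g (edges0 x)) else last L0 (map g (edges120 x)))
        == nth L0 caps x].

Definition right_ok g : bool := map g (edges60 z) == bits (rev epsilon).

Fixpoint columns_ok n g : bool :=
  if n is n'.+1 then column_ok (z - n) g && columns_ok n' g else right_ok g.

Definition puzzle_on g : bool :=
  [&& [&& map g (side_NW beta) == bits beta, map g (side_N beta gamma) == bits gamma,
          map g (side_NE beta gamma delta) == bits delta,
          map g (side_SE epsilon zeta) == bits epsilon
        & map g (side_S zeta) == bits zeta],
      all (fun p => up_in_pent beta gamma zeta p ==>
             up_ok (g (Deg60, p)) (g (Deg120, p)) (g (Deg0, p))) (pent_box beta zeta)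
    & all (fun p => down_in_pent beta gamma zeta p ==>
             down_ok (g (Deg0, (p.1, p.2.+1))) (g (Deg60, (p.1.+1, p.2))) (g (Deg120, p)))
          (pent_box beta zeta)].

Definition in_columns n (a : edge) : bool :=
  let: (t, (x, y)) := a in
  match t with
  | Deg0 => (z - n <= x < z) && (y < (height x.+1).+1)
  | Deg120 => (z - n <= x < z) && (y < height x)
  | Deg60 => (z - n < x <= z) && (y < height x)
  end%N.

Lemma mem_segment (t t' : direction) (x x' y n : nat) :
  ((t', (x', y)) \in [seq (t, (x, i)) | i <- iota 0 n]) =
  [&& t' == t, x' == x & (y < n)%N].
Proof.
apply/mapP/and3P => [[i]|[/eqP-> /eqP-> ltyn]]; last by exists y; rewrite ?mem_iota.
by rewrite mem_iota => /= ltin [-> -> ->].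
Qed.

Lemma uniq_segment (t : direction) (x n : nat) :
  uniq [seq (t, (x, i)) : edge | i <- iota 0 n].
Proof. by rewrite map_inj_uniq ?iota_uniq // => i j []. Qed.

Lemma mem_columns n a : (n <= z)%N -> (a \in columns n) = in_columns n a.
Proof.
elim: n a => [|n IHn] [t [x y]] ltnz.
  by rewrite in_nil; case: t => /=; lia.
rewrite mem_cat IHn ?(ltnW ltnz) // !mem_cat !mem_segment.
case: t => /=; rewrite ?andbF ?orbF /=.
- by have [->|] := eqVneq x (z - n.+1)%N => /=; lia.
- have [->|] := eqVneq x (z - n.+1).+1%N => /=; lia.
by have [->|] := eqVneq x (z - n.+1)%N => /=; lia.
Qed.

Lemma columns_edges : edges60 0 ++ columns z =i edgesP.
Proof.
move=> [t [x y]]; rewrite mem_cat mem_columns // mem_segment.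
have -> : ((t, (x, y)) \in edgesP) = edge_in_pent beta gamma zeta (t, (x, y)).
  rewrite mem_filter andbC; apply: andb_idl; rewrite /edge_in_pent /in_pent => ep.
  apply/allpairsP; exists (t, (x, y)); split=> //; first by case: (t).
  apply/allpairsP; exists (x, y); split=> //; rewrite mem_iota;
  by case: t ep => /=; lia.
rewrite /edge_in_pent /in_pent /in_columns /height -/b -/c -/z.
by case: t => /=; lia.
Qed.

Lemma uniq_columns : uniq (edges60 0 ++ columns z).
Proof.
have uniq_cols n : (n <= z)%N -> uniq (columns n).
  elim: n => // n IHn ltnz.
  rewrite -[columns n.+1]/(column (z - n.+1) ++ columns n) cat_uniq IHn ?(ltnW ltnz) // andbT.
  apply/andP; split.
    rewrite /column !cat_uniq !uniq_segment !andbT !andTb; apply/andP; split.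
      by apply/hasPn => -[t [x y]]; rewrite mem_cat !mem_segment; case: t.
    by apply/hasPn => -[t [x y]]; rewrite !mem_segment; case: t.
  apply/hasPn => -[t [x y]]; rewrite mem_columns ?(ltnW ltnz) // !mem_cat !mem_segment.
  by case: t => /=; lia.
rewrite cat_uniq uniq_segment uniq_cols // andbT; apply/hasPn => -[t [x y]].
by rewrite mem_columns // mem_segment; case: t => /=; lia.
Qed.

Lemma height_cap x : (x < z)%N -> height x = (height x.+1 + ~~ (x < c))%N.
Proof. by rewrite /height; case: ltnP => /=; lia. Qed.

Lemma column_okP x g : (x < z)%N ->
  reflect
    [/\ forall y, (y < height x)%N ->
          up_ok (g (Deg60, (x, y))) (g (Deg120, (x, y))) (g (Deg0, (x, y))),
        forall y, (y < height x.+1)%N ->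
          down_ok (g (Deg0, (x, y.+1))) (g (Deg60, (x.+1, y))) (g (Deg120, (x, y))),
        g (Deg0, (x, 0%N)) = nth L0 bottoms x
      & (if (x < c)%N then g (Deg0, (x, b))
         else g (Deg120, (x, b + c - x.+1)%N)) = nth L0 caps x]
    (column_ok x g).
Proof.
move=> ltxz; rewrite /column_ok /edges60 /edges120 /edges0 -!map_comp.
have -> : (if (x < c)%N
   then last L0 (map (g \o (fun y => (Deg0, (x, y)))) (iota 0 (height x.+1).+1))
   else last L0 (map (g \o (fun y => (Deg120, (x, y)))) (iota 0 (height x)))) =
   (if (x < c)%N then g (Deg0, (x, b)) else g (Deg120, (x, b + c - x.+1)%N)).
  case: ltnP => [ltxc|lecx].
    by rewrite -nth_last size_map size_iota (nth_map 0%N) ?size_iota // nth_iota //= /height;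
       congr (g (_, (_, _))); lia.
  have hx : (height x).-1 = (b + c - x.+1)%N by rewrite /height; lia.
  have h0 : (0 < height x)%N by rewrite /height; lia.
  rewrite -nth_last size_map size_iota (nth_map 0%N) ?size_iota ?nth_iota ?hx //; lia.
rewrite (height_cap ltxz) fits_iota -(height_cap ltxz).
apply: (iffP and3P) => [[/andP[/allP ups /allP downs] /eqP bot /eqP top]|[ups downs bot top]].
  split=> // y lty; first by apply: (ups y); rewrite mem_iota.
  by apply: (downs y); rewrite mem_iota.
split; [apply/andP; split; apply/allP => y | exact/eqP | exact/eqP].
  by rewrite mem_iota; apply: ups.
by rewrite mem_iota; apply: downs.
Qed.

Lemma columns_okP n g : (n <= z)%N ->
  reflect ((forall x, (z - n <= x < z)%N -> column_ok x g) /\ right_ok g) (columns_ok n g).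
Proof.
elim: n => [|n IHn] ltnz /=.
  by apply: (iffP idP) => [ok|[]] //; split=> // x; lia.
apply: (iffP andP) => [[ok /(IHn (ltnW ltnz))[oks rok]]|[oks rok]].
  split=> // x ltx; have [->//|nx] := eqVneq x (z - n.+1)%N.
  by apply: oks; lia.
split; first by apply: oks; lia.
by apply/(IHn (ltnW ltnz)); split=> // x ltx; apply: oks; lia.
Qed.

Lemma nth_bits_rev w i : (i < size w)%N ->
  nth L0 (bits (rev w)) i = nth L0 (bits w) (size w - i.+1).
Proof. by move=> lti; rewrite /bits map_rev nth_rev size_map. Qed.

Lemma nth_caps x : nth L0 caps x =
  if (x < c)%N then nth L0 (bits gamma) x else nth L0 (bits delta) (x - c).
Proof. by rewrite /caps /bits map_cat nth_cat size_map. Qed.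

Lemma box_forall (P : pred point) (Q : nat -> nat -> bool) (R : nat -> nat -> bool) :
    (forall x y, P (x, y) = R x y) ->
    (forall x y, R x y -> (x <= z) && (y <= b))%N ->
  reflect (forall x y, R x y -> Q x y)
          (all (fun p => P p ==> Q p.1 p.2) (pent_box beta zeta)).
Proof.
move=> PR boxR; apply: (iffP allP) => [PQ x y Rxy|RQ p _].
  have /= := PQ (x, y); rewrite PR Rxy; apply.
  have /andP[lex ley] := boxR _ _ Rxy.
  by apply/allpairsP; exists (x, y); rewrite !mem_iota.
by apply/implyP; case: p => x y; rewrite PR => /RQ.
Qed.

(** N and NE labels become end labels of columns and S labels their bottoms. Clockwise reading runs
    against the columns on SE and S, whence the reversals. *)
Lemma puzzle_onE g : puzzle_on g = (map g (edges60 0) == bits beta) && columns_ok z g.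
Proof.
have h0 : height 0 = b by rewrite /height; lia.
have hz : height z = e by rewrite /height; lia.
pose ups := forall x y, (x < z)%N && (y < height x)%N ->
  up_ok (g (Deg60, (x, y))) (g (Deg120, (x, y))) (g (Deg0, (x, y))).
pose downs := forall x y, (x < z)%N && (y < height x.+1)%N ->
  down_ok (g (Deg0, (x, y.+1))) (g (Deg60, (x.+1, y))) (g (Deg120, (x, y))).
have upsP : reflect ups (all (fun p => up_in_pent beta gamma zeta p ==>
             up_ok (g (Deg60, p)) (g (Deg120, p)) (g (Deg0, p))) (pent_box beta zeta)).
  rewrite (eq_all (a2 := fun p => up_in_pent beta gamma zeta p ==>
     up_ok (g (Deg60, (p.1, p.2))) (g (Deg120, (p.1, p.2)))
           (g (Deg0, (p.1, p.2))))); last by case.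
  apply: (box_forall (fun x y =>
    up_ok (g (Deg60, (x, y))) (g (Deg120, (x, y))) (g (Deg0, (x, y))))) => x y.
    by rewrite /up_in_pent /in_pent /height /= -/b -/c -/z; lia.
  by rewrite /height; lia.
have downsP : reflect downs (all (fun p => down_in_pent beta gamma zeta p ==>
             down_ok (g (Deg0, (p.1, p.2.+1))) (g (Deg60, (p.1.+1, p.2))) (g (Deg120, p)))
          (pent_box beta zeta)).
  rewrite (eq_all (a2 := fun p => down_in_pent beta gamma zeta p ==>
     down_ok (g (Deg0, (p.1, p.2.+1))) (g (Deg60, (p.1.+1, p.2)))
             (g (Deg120, (p.1, p.2))))); last by case.
  apply: (box_forall (fun x y =>
    down_ok (g (Deg0, (x, y.+1))) (g (Deg60, (x.+1, y))) (g (Deg120, (x, y))))) => x y.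
    by rewrite /down_in_pent /in_pent /height /= -/b -/c -/z; lia.
  by rewrite /height; lia.
have szb (w : seq bool) : size (bits w) = size w by rewrite size_map.
have right_okP : reflect
    (forall y, (y < e)%N -> g (Deg60, (z, y)) = nth L0 (bits (rev epsilon)) y)
    (right_ok g).
  rewrite /right_ok /edges60 hz -map_comp.
  by apply: map_eqP; rewrite szb size_rev.
rewrite /puzzle_on /side_NW /side_N /side_NE /side_SE /side_S -/b -/c -/d -/e -/z -!map_comp.
rewrite -andbA ?h0; congr andb.
apply/andP/(columns_okP _ (leqnn z)).
  case=> /and4P[/(map_eqP L0 _ (szb _)) N /(map_eqP L0 _ (szb _)) NE].
  move=> /(map_eqP L0 _ (szb _)) SE /(map_eqP L0 _ (szb _)) S /andP[allU allD].
  have U := elimT upsP allU; have D := elimT downsP allD; split=> [x /andP[_ ltxz]|].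
    apply/column_okP => //; split=> [y lty|y lty||].
    - by apply: U; rewrite ltxz.
    - by apply: D; rewrite ltxz.
    - rewrite nth_bits_rev // -S /=; last by rewrite -/z; lia.
      by congr (g (_, (_, _))); rewrite -/z; lia.
    - rewrite nth_caps; case: ltnP => [ltxc|lecx]; first by rewrite -N.
      by rewrite -NE /=; [congr (g (_, (_, _))); lia | rewrite -/d; lia].
  apply: (introT right_okP) => y lty; rewrite nth_bits_rev // -SE /= -/e; last by lia.
  by congr (g (_, (_, _))); lia.
case=> cols /(elimT right_okP) R.
have col x : (x < z)%N -> column_ok x g by move=> ltx; apply: cols; lia.
split; [apply/and4P; split | apply/andP; split].
- apply/(map_eqP L0 _ (szb _)) => i lti; have ltiz : (i < z)%N by lia.
  by have /(column_okP g ltiz)[_ _ _] := col i ltiz; rewrite nth_caps lti.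
- apply/(map_eqP L0 _ (szb _)) => i lti; have ltiz : (c + i < z)%N by lia.
  have /(column_okP g ltiz)[_ _ _] := col _ ltiz.
  rewrite nth_caps ltnNge leq_addr /= addKn => <-.
  by congr (g (_, (_, _))); lia.
- apply/(map_eqP L0 _ (szb _)) => i lti.
  rewrite /= R; last by lia.
  by rewrite nth_bits_rev -/e; [congr nth; lia | lia].
- apply/(map_eqP L0 _ (szb _)) => i lti; have ltiz : (z - i.+1 < z)%N by lia.
  have /(column_okP g ltiz)[_ _ + _] := col _ ltiz.
  rewrite /= => ->; rewrite nth_bits_rev -/z; last by [].
  by congr nth; lia.
- apply: (introT upsP) => x y /andP[ltx lty].
  by have /(column_okP g ltx)[+ _ _ _] := col x ltx; apply.
- apply: (introT downsP) => x y /andP[ltx lty].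
  by have /(column_okP g ltx)[_ + _ _] := col x ltx; apply.
Qed.

Lemma column_ok_local x : local (edges60 x ++ column x) (column_ok x).
Proof.
move=> g g' eqg.
have eqm E : {subset E <= edges60 x ++ column x} -> map g E = map g' E.
  by move=> subE; apply/eq_in_map => a /subE/eqg.
rewrite /column_ok !eqm // => a aE; rewrite /column !mem_cat aE ?orbT //.
Qed.

Lemma columns_ok_local n : (n <= z)%N ->
  local (edges60 (z - n) ++ columns n) (columns_ok n).
Proof.
elim: n => [|n IHn] ltnz g g' eqg /=.
  rewrite /right_ok; congr (_ == _); apply/eq_in_map => a aE.
  by apply: eqg; rewrite subn0 mem_cat aE.
have Ez : (z - n = (z - n.+1).+1)%N by lia.
congr andb.
  apply: column_ok_local => a; rewrite mem_cat => aE; apply: eqg.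
  by rewrite mem_cat [in X in _ || X]mem_cat orbA aE.
apply: (IHn (ltnW ltnz)) => a aE; apply: eqg.
move: aE; rewrite Ez !mem_cat; case/orP=> ->; rewrite !orbT //.
Qed.

Lemma columns_disjoint n : (n < z)%N ->
  [predI edges60 (z - n.+1) ++ column (z - n.+1) & columns n] =1 pred0.
Proof.
move=> ltnz [t [x y]] /=; rewrite !mem_cat mem_columns ?(ltnW ltnz) // !mem_segment.
by case: t => /=; lia.
Qed.

Lemma column_disjoint x : [predI edges60 x & column x] =1 pred0.
Proof.
move=> [t [x' y]] /=; rewrite !mem_cat !mem_segment.
by case: t => /=; lia.
Qed.

Lemma uniq_column x : uniq (column x).
Proof.
rewrite /column !cat_uniq !uniq_segment !andbT !andTb; apply/andP; split.
  by apply/hasPn => -[t [x' y]]; rewrite mem_cat !mem_segment; case: t.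
by apply/hasPn => -[t [x' y]]; rewrite !mem_segment; case: t.
Qed.

Lemma assign_column g x (k m r : seq label) :
    size k = size (edges0 x) -> size m = size (edges120 x) ->
    size r = size (edges60 x.+1) ->
  let g' := assign g (column x) (k ++ m ++ r) in
  [/\ map g' (edges60 x) = map g (edges60 x), map g' (edges0 x) = k,
      map g' (edges120 x) = m & map g' (edges60 x.+1) = r].
Proof.
move=> szk szm szr g'.
have : map g' (column x) == k ++ m ++ r.
  by rewrite map_assign ?uniq_column // !size_cat szk szm szr.
rewrite !map_cat !eqseq_cat ?(size_map g') ?szk ?szm // => /and3P[/eqP E0 /eqP E1 /eqP E2].
by split=> //; apply: (map_assign_notin _ _ (@column_disjoint x)).
Qed.

(** Later columns see only the right side of this one, so its other edges can be summed out by
    [sum_fits]. *)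
Lemma count_column n x g (F : seq label -> rat) :
    (n < z)%N -> x = (z - n.+1)%N ->
    (forall g, count_assign (columns n) g (columns_ok n) = F (map g (edges60 (z - n)))) ->
  count_assign (columns n.+1) g (columns_ok n.+1) =
  \sum_(r : (height x.+1).-tuple label)
     cell (x < c)%N (nth L0 bottoms x) (map g (edges60 x)) (nth L0 caps x) r * F r.
Proof.
move=> ltnz x_eq IH; have Ex : (z - n = x.+1)%N by lia.
have ltxz : (x < z)%N by lia.
have dis : [predI column x & columns n] =1 pred0.
  move=> a; have := columns_disjoint ltnz a; rewrite /= mem_cat -x_eq.
  by case: (a \in column x); rewrite ?orbT.
rewrite [columns n.+1]/= -/(column _) -x_eq.
rewrite (count_assign_cat _ (columns_ok_local ltnz) dis).
transitivity (\sum_(w : (size (column x)).-tuple label)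
    (column_ok x (assign g (column x) w))%:R *
    F (map (assign g (column x) w) (edges60 x.+1))).
  apply: eq_bigr => w _; rewrite -Ex -IH mulr_sumr; apply: eq_bigr => w2 _.
  rewrite -natrM mulnb [columns_ok n.+1 _]/= -x_eq; congr (nat_of_bool (_ && _))%:R.
  apply: column_ok_local => a aE; apply: assign_notin.
  have /= := columns_disjoint ltnz a; rewrite -x_eq aE /=.
  by move/negbT.
have s0 : size (edges0 x) = (height x.+1).+1 by rewrite size_map size_iota.
have s1 : size (edges120 x) = (height x.+1 + ~~ (x < c))%N.
  by rewrite size_map size_iota height_cap.
have s2 : size (edges60 x.+1) = height x.+1 by rewrite size_map size_iota.
pose G w := (column_ok x (assign g (column x) w))%:R *
    F (map (assign g (column x) w) (edges60 x.+1)).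
rewrite -[LHS]/(\sum_(w : (size (column x)).-tuple label) G w).
have -> : size (column x) = ((height x.+1).+1 + ((height x.+1 + ~~ (x < c)) + height x.+1))%N.
  by rewrite !size_cat s0 s1 s2.
rewrite (big_tuple_cat _ _ G).
under eq_bigr => k _ do rewrite (big_tuple_cat _ _ (fun w => G (k ++ w))).
under eq_bigr => k _ do rewrite exchange_big /=.
rewrite exchange_big /=; apply: eq_bigr => r _.
rewrite -(@sum_fits _ _ (height x.+1)) ?size_tuple //; last first.
  exact: height_cap.
rewrite mulr_suml; apply: eq_bigr => k _; rewrite mulr_suml; apply: eq_bigr => m _.
have [] := assign_column g (etrans (size_tuple k) (esym s0))
  (etrans (size_tuple m) (esym s1)) (etrans (size_tuple r) (esym s2)).
by rewrite /G /column_ok => -> -> -> ->.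
Qed.

Lemma count_trap n g : (n <= d)%N ->
  count_assign (columns n) g (columns_ok n) =
  trap (map g (edges60 (z - n))) (drop (z - n) caps) (drop (z - n) bottoms)
       (bits (rev epsilon)).
Proof.
have szc : size caps = z by rewrite /caps /bits size_map size_cat z_eq.
have szb : size bottoms = z by rewrite /bottoms /bits size_map size_rev.
elim: n g => [|n IHn] g ltnd.
  rewrite subn0 !drop_oversize ?szc ?szb //.
  rewrite /count_assign (big_tuple_nil (fun w => (columns_ok 0 (assign g (columns 0) w))%:R)).
  rewrite /= /right_ok; congr (nat_of_bool (_ == _))%:R.
have ltnz : (n < z)%N by lia.
have Ez : (z - n = (z - n.+1).+1)%N by lia.
have ltxz : (z - n.+1 < z)%N by lia.
rewrite (@count_column n (z - n.+1) g (fun r => trap r (drop (z - n) caps) (drop (z - n) bottoms)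
  (bits (rev epsilon)))) //; last by move=> g'; apply/IHn/ltnW.
rewrite [drop (z - n.+1) caps](drop_nth L0) ?szc //.
rewrite [drop (z - n.+1) bottoms](drop_nth L0) ?szb //.
rewrite trap_cons.
have -> : (z - n.+1 < c)%N = false by lia.
rewrite -Ez.
rewrite /cell size_map /edges60 size_map size_iota.
have -> : (height (z - n.+1)).-1 = height (z - n.+1).+1 by rewrite /height; lia.
by rewrite -Ez.
Qed.

(** Under the N side the columns have constant height and form a parallelogram, joined along [w] to
    the last [d] columns from [count_trap]. *)
Lemma count_par n g : (n <= c)%N ->
  count_assign (columns (n + d)) g (columns_ok (n + d)) =
  \sum_(w : b.-tuple label)
    par (map g (edges60 (c - n))) (drop (c - n) (bits gamma))
        (drop (c - n) (take c bottoms)) w *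
    trap w (bits delta) (drop c bottoms) (bits (rev epsilon)).
Proof.
have szc : size caps = z by rewrite /caps /bits size_map size_cat z_eq.
have szb : size bottoms = z by rewrite /bottoms /bits size_map size_rev.
have szt : size (take c bottoms) = c by rewrite size_takel // szb; lia.
have szg : size (bits gamma) = c by rewrite size_map.
elim: n g => [|n IHn] g lenc.
  rewrite add0n subn0 count_trap //.
  rewrite [drop c (bits gamma)]drop_oversize ?szg // [drop c (take _ _)]drop_oversize ?szt //.
  have -> : (z - d = c)%N by lia.
  have -> : drop c caps = bits delta by rewrite /caps /bits map_cat drop_size_cat // size_map.
  rewrite -(@big_tuple_delta _ b (map g (edges60 c))
    (fun w => trap w (bits delta) (drop c bottoms) (bits (rev epsilon)))) //.
  by rewrite size_map /edges60 size_map size_iota /height; lia.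
have ltnz : (n + d < z)%N by lia.
have Ez : (z - (n + d) = c - n)%N by lia.
have Ex : (c - n.+1 = z - (n + d).+1)%N by lia.
have Ec : (c - n = (c - n.+1).+1)%N by lia.
have ltxc : (c - n.+1 < c)%N by lia.
rewrite addSn (@count_column (n + d) (c - n.+1) g (fun r => \sum_(w : b.-tuple label)
    par r (drop (c - n) (bits gamma)) (drop (c - n) (take c bottoms)) w *
    trap w (bits delta) (drop c bottoms) (bits (rev epsilon))) ltnz Ex); last first.
  by move=> g'; rewrite IHn ?(ltnW lenc) // Ez.
rewrite ltxc [drop (c - n.+1) (bits gamma)](drop_nth L0) ?szg //.
rewrite [drop (c - n.+1) (take _ _)](drop_nth L0) ?szt // -Ec.
have hx : height (c - n) = b by rewrite /height; lia.
have hx1 : height (c - n.+1) = b by rewrite /height; lia.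
rewrite hx.
under eq_bigr do rewrite mulr_sumr.
rewrite exchange_big; apply: eq_bigr => w _ /=.
have szl : size (map g (edges60 (c - n.+1))) = b.
  by rewrite size_map /edges60 size_map size_iota.
rewrite szl mulr_suml; apply: eq_bigr => r _.
by rewrite mulrA /cell nth_caps ltxc nth_take.
Qed.

Lemma PentE : (Pent beta gamma delta epsilon zeta)%:R =
  \sum_(w : b.-tuple label)
    par (bits beta) (bits gamma) (bits (take c (rev zeta))) w *
    trap w (bits delta) (bits (drop c (rev zeta))) (bits (rev epsilon)).
Proof.
have memE t x y : ((t, (x, y)) \in edgesP) = edge_in_pent beta gamma zeta (t, (x, y)).
  rewrite -columns_edges mem_cat mem_columns // mem_segment.
  rewrite /edge_in_pent /in_pent /in_columns /height -/b -/c -/z.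
  by case: t => /=; lia.
pose Phi (f : labeling beta gamma zeta) := is_puzzle delta epsilon f.
have Phi_on (f : labeling beta gamma zeta) g :
    (forall a, g (val a) = f a) -> Phi f = puzzle_on g.
  move=> gf.
  have labE a : a \in edgesP -> label_at f a = Some (g a).
    by move=> aE; rewrite /label_at insubT /= -gf.
  have agreeE s w : {subset s <= edgesP} -> agrees f s w = (map g s == bits w).
    move=> subs; rewrite /agrees.
    have -> : [seq label_at f a | a <- s] = map Some (map g s).
      by rewrite -map_comp; apply/eq_in_map => a /subs/labE.
    by rewrite [X in _ == X](map_comp Some label_of_bit) (inj_eq (inj_map Some_inj)).
  have pieceE a1 a2 a3 : a1 \in edgesP -> a2 \in edgesP -> a3 \in edgesP ->
      is_piece f (a1, a2, a3) = ((g a1, g a2, g a3) \in pieces).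
    by move=> E1 E2 E3; rewrite /is_piece !labE.
  rewrite /Phi /is_puzzle /puzzle_on !agreeE; last first.
  - by move=> _ /mapP[i + ->]; rewrite mem_iota memE /edge_in_pent /in_pent /=; lia.
  - by move=> _ /mapP[i + ->]; rewrite mem_iota memE /edge_in_pent /in_pent /=; lia.
  - by move=> _ /mapP[i + ->]; rewrite mem_iota memE /edge_in_pent /in_pent /=; lia.
  - by move=> _ /mapP[i + ->]; rewrite mem_iota memE /edge_in_pent /in_pent /=; lia.
  - by move=> _ /mapP[i + ->]; rewrite mem_iota memE /edge_in_pent /in_pent /=; lia.
  congr [&& _, _ & _]; apply: eq_all => -[x y]; apply: implyb_id2l => inp;
    rewrite pieceE // memE; move: inp;
    rewrite /up_in_pent /down_in_pent /edge_in_pent /in_pent /=; lia.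
rewrite (card_assign uniq_columns columns_edges Phi_on).
have loc : local (edges60 0 ++ columns z) puzzle_on.
  move=> g g' eqg; rewrite !puzzle_onE; congr andb.
    by congr (_ == _); apply/eq_in_map => a aE; apply: eqg; rewrite mem_cat aE.
  by apply: (columns_ok_local (leqnn z)); rewrite subnn.
have dis : [predI edges60 0 & columns z] =1 pred0.
  move=> [t [x y]] /=; rewrite mem_columns // mem_segment.
  by case: t => /=; lia.
rewrite (count_assign_cat _ loc dis).
have sz0 : size (edges60 0) = b by rewrite size_map size_iota /height; lia.
pose g0 : edge -> label := fun=> L0.
pose X l := \sum_(w : b.-tuple label) par l (bits gamma) (take c bottoms) w *
    trap w (bits delta) (drop c bottoms) (bits (rev epsilon)).
have szbb : size (bits beta) = b by rewrite size_map.
rewrite sz0.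
transitivity (\sum_(l : b.-tuple label) (bits beta == l)%:R * X l); last first.
  by rewrite big_tuple_delta // /X /bottoms /bits map_take map_drop.
apply: eq_bigr => l _.
have E60 : map (assign g0 (edges60 0) l) (edges60 0) = l.
  by rewrite map_assign ?uniq_segment // size_tuple sz0.
have := @count_par c (assign g0 (edges60 0) l) (leqnn c).
rewrite -z_eq subnn E60 !drop0 -/(X l) => <-.
rewrite /count_assign mulr_sumr; apply: eq_bigr => w _.
rewrite puzzle_onE -natrM mulnb; congr (nat_of_bool (_ && _))%:R.
rewrite -[in RHS]E60 eq_sym; congr (_ == _).
by apply: map_assign_notin.
Qed.

End Columns.

(** * Commuting the sides *)

Lemma bsort_id w : bsort (bsort w) = bsort w.
Proof. by apply: eq_bsort; rewrite ?size_bsort ?ones_bsort. Qed.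

Lemma Pent_tri beta gamma delta epsilon zeta :
    size beta = (size delta + size gamma)%N -> size zeta = size beta ->
    size epsilon = size gamma -> ones epsilon = ones gamma ->
  (Pent beta gamma delta epsilon zeta)%:R =
  tri (bsort gamma ++ delta ++ bsort gamma) (beta ++ gamma)
      (rev zeta ++ rev epsilon).
Proof.
move=> szb szz sze oe; rewrite PentE ?szz ?szb ?sze //; last by rewrite addnC.
have szrz : size (rev zeta) = (size gamma + size delta)%N.
  by rewrite size_rev szz szb addnC.
have lec : (size gamma <= size (rev zeta))%N by rewrite szrz leq_addr.
have szd : size (drop (size gamma) (rev zeta)) = size delta.
  by rewrite size_drop szrz addKn.
rewrite -[in RHS](cat_take_drop (size gamma) (rev zeta)) tri_corners
  ?size_bsort ?ones_bsort ?bsort_id ?size_rev ?count_rev ?(size_takel lec) //.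
by rewrite szb.
Qed.

Lemma binstrP n k w : reflect (size w = n /\ ones w = k) (w \in binstr n k).
Proof. by apply: (iffP andP) => -[/eqP ? /eqP ?]. Qed.

(** The glued sides are sorted words fixed by the contents, so a single [q] serves all boundary
    words. *)
Lemma Pent_hop_poly b0 b1 c0 c1 delta :
    (b0 + b1)%N = (size delta + (c0 + c1))%N ->
  exists q, forall beta gamma epsilon zeta,
    beta \in binstr (b0 + b1) b1 -> zeta \in binstr (b0 + b1) b1 ->
    gamma \in binstr (c0 + c1) c1 -> epsilon \in binstr (c0 + c1) c1 ->
  (Pent beta gamma delta epsilon zeta)%:R =
  hop_poly (b0 + b1 + (c0 + c1)) q (beta ++ gamma) (rev zeta ++ rev epsilon).
Proof.
move=> b_eq; pose b := (b0 + b1)%N; pose c := (c0 + c1)%N.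
pose word i j := nseq i false ++ nseq j true.
have szw i j : size (word i j) = (i + j)%N by rewrite size_cat !size_nseq.
have ow i j : ones (word i j) = j by rewrite count_cat !count_nseq mul0n mul1n.
have word_bsort n i j w : n = (i + j)%N -> w \in binstr n j -> bsort w = word i j.
  move=> -> /binstrP[szw' ow']; rewrite -[word i j](bsort_sorted i j).
  by apply: eq_bsort; rewrite ?szw ?ow.
pose P := word c0 c1 ++ delta ++ word c0 c1.
pose S := word (b0 + c0)%N (b1 + c1)%N.
have szP : size P = (b + c)%N by rewrite /P 2!size_cat !szw -/c /b b_eq; lia.
have szS : size S = (b + c)%N by rewrite szw /b /c; lia.
have [|q Eq] := @commutant_poly (b + c) S (tri P) (fun x => tri_comm x szP) szS.
  move=> v szv /tri_ones; rewrite ow => ov.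
  apply: (word_bsort (b + c)%N); first by rewrite -szS szw.
  by apply/binstrP.
exists q => beta gamma epsilon zeta /binstrP[szb ob] /binstrP[szz oz] gam.
move: (gam) => /binstrP[szg og] /binstrP[sze oe].
rewrite Pent_tri ?szb ?szz ?szg ?sze ?og ?oe // (word_bsort c c0 c1 _ erefl gam).
rewrite Eq ?size_cat ?size_rev ?szb ?szg ?szz ?sze //.
apply: (word_bsort (b + c)%N); first by rewrite /b /c; lia.
by apply/binstrP; rewrite size_cat count_cat szb szg ob og.
Qed.

Local Close Scope ring_scope.

Theorem corollary5
  (b0 b1 c0 c1 d0 d1 e0 e1 z0 z1 : nat)
  (hbcez0 : b0 + c0 = e0 + z0) (hbcez1 : b1 + c1 = e1 + z1)
  (hbde0 : b0 = d0 + e0) (hbde1 : b1 = d1 + e1)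
  (hcdz0 : c0 + d0 = z0) (hcdz1 : c1 + d1 = z1)
  (beta gamma delta epsilon zeta : seq bool)
  (hbeta : beta \in binstr (b0 + b1) b1)
  (hgamma : gamma \in binstr (c0 + c1) c1)
  (hdelta : delta \in binstr (d0 + d1) d1)
  (hepsilon : epsilon \in binstr (e0 + e1) e1)
  (hzeta : zeta \in binstr (z0 + z1) z1)
  (hsort : bsort beta = bsort zeta) :
  bsort gamma = bsort epsilon /\
  [/\ Pent beta gamma delta epsilon zeta = Pent zeta gamma delta epsilon beta,
      Pent zeta gamma delta epsilon beta = Pent beta epsilon delta gamma zeta
    & Pent beta epsilon delta gamma zeta = Pent zeta epsilon delta gamma beta].
Proof.
have [szb ob] := binstrP _ _ _ hbeta; have [szz oz] := binstrP _ _ _ hzeta.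
have [szg og] := binstrP _ _ _ hgamma; have [sze oe] := binstrP _ _ _ hepsilon.
have [szd od] := binstrP _ _ _ hdelta.
(* Equal sorted words have equal contents; the numerical hypotheses then identify [e0], [e1] with
   [c0], [c1]. *)
have eq1 : z1 = b1 by rewrite -oz -ob -(ones_bsort beta) hsort ones_bsort.
have eq2 : (z0 + z1 = b0 + b1)%N.
  by rewrite -szz -szb -(size_bsort beta) hsort size_bsort.
have ee1 : e1 = c1 by lia.
have ee0 : e0 = c0 by lia.
have ez0 : z0 = b0 by lia.
move: hzeta hepsilon; rewrite eq1 ez0 ee0 ee1 => hzeta' hepsilon'.
split; first by apply: eq_bsort; rewrite ?szg ?sze ?og ?oe ee1 ?ee0.
have b_eq : (b0 + b1 = size delta + (c0 + c1))%N by rewrite szd; lia.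
have [q Eq] := Pent_hop_poly b_eq.
have ez1 : size zeta = b0 + b1 by rewrite szz.
have ee : size epsilon = c0 + c1 by rewrite sze ee0 ee1.
have oz1 : count_mem true zeta = b1 by rewrite oz.
have oe1 : count_mem true epsilon = c1 by rewrite oe.
(* Reversing the first blocks turns the pair [beta], [rev zeta] into [zeta], [rev beta]. *)
have swap_beta g' e' : g' \in binstr (c0 + c1) c1 -> e' \in binstr (c0 + c1) c1 ->
    Pent beta g' delta e' zeta = Pent zeta g' delta e' beta.
  move=> hg he; have [szg' og'] := binstrP _ _ _ hg; have [sze' oe'] := binstrP _ _ _ he.
  apply/eqP; rewrite -(eqr_nat rat) !Eq //.
  rewrite (@hop_poly_revl (b0 + b1) (c0 + c1)) ?size_rev ?count_rev ?revK ?ob ?oz1 //.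
have swap_gamma b' z' : b' \in binstr (b0 + b1) b1 -> z' \in binstr (b0 + b1) b1 ->
    Pent b' gamma delta epsilon z' = Pent b' epsilon delta gamma z'.
  move=> hb hz; have [szb' ob'] := binstrP _ _ _ hb; have [szz' oz'] := binstrP _ _ _ hz.
  apply/eqP; rewrite -(eqr_nat rat) !Eq //.
  by rewrite (@hop_poly_revr (b0 + b1) (c0 + c1)) ?size_rev ?count_rev ?revK ?ob' ?oz'.
by rewrite (swap_beta gamma epsilon) // -(swap_beta epsilon gamma) // -swap_gamma // -swap_beta.
Qed.
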